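(* For every integer $n\ge2$, $$\frac{1}{2^8\cdot3^2}\le\frac{\operatorname{vrad}(\widetilde{\mathrm{SOS}_{\mathcal Q}})}{\operatorname{vrad}(\widetilde{\mathrm{POS}_{\mathcal Q}})}\le 1,$$ where $$\widetilde{\mathrm{POS}_{\mathcal Q}}=\Big\{f\in\mathcal Q:\ \int_{S^{n-1}}f\,d\sigma=0\ \text{ and }\ f+(x_1^2+\dots+x_n^2)^2\in\mathrm{POS}_{\mathcal Q}\Big\},$$ $$\widetilde{\mathrm{SOS}_{\mathcal Q}}=\Big\{f\in\mathcal Q:\ \int_{S^{n-1}}f\,d\sigma=0\ \text{ and }\ f+(x_1^2+\dots+x_n^2)^2\in\mathrm{SOS}_{\mathcal Q}\Big\}.$$
   Context: $\mathbb R[x]_k$ denotes the space of real forms (homogeneous polynomials) of degree $k$ in $x=(x_1,\dots,x_n)$. $\mathcal Q=\{\sum_{i,j=1}^n a_{ij}x_i^2x_j^2: a_{ij}=a_{ji}\in\mathbb R\}\subset\mathbb R[x]_4$ is the space of even quartic forms. $\mathrm{POS}_{\mathcal Q}$ is the set of $f\in\mathcal Q$ with $f(x)\ge0$ for all $x\in\mathbb R^n$. $\mathrm{SOS}_{\mathcal Q}$ is the set of $f\in\mathcal Q$ that are finite sums $f=\sum_i f_i^2$ with $f_i\in\mathbb R[x]_2$. $\sigma$ is the rotation invariant probability measure on the unit sphere $S^{n-1}\subset \mathbb R^n$. $\mathcal M=\{f\in\mathcal Q:\int_{S^{n-1}}f\,d\sigma=0\}$ is a Euclidean space of dimension $\frac{n(n+1)}2-1$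 with the inner product $\langle f,g\rangle=\int_{S^{n-1}}fg\,d\sigma$; $\mathrm{Vol}$ on $\mathcal M$ is the pushforward of Lebesgue measure under any linear isometry $\mathbb R^{\dim\mathcal M}\to\mathcal M$. For compact measurable $C\subseteq\mathcal M$, $\operatorname{vrad}(C)=(\mathrm{Vol}(C)/\mathrm{Vol}(B))^{1/\dim\mathcal M}$, where $B$ is the unit ball of $\mathcal M$. *)

(* Defs.v *)
From HB Require Import structures.
From mathcomp Require Import all_boot all_order all_algebra.
(* [mpoly] has to be imported before [all_analysis]: in the other order, their
   notations at level 2 clash. *)
From mathcomp.multinomials Require Import mpoly.
From mathcomp Require Import all_classical all_reals all_analysis.

Set Implicit Arguments.
Unset Strict Implicit.
Unset Printing Implicit Defensive.

Import Order.TTheory GRing.Theory Num.Theory.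

Local Open Scope classical_set_scope.
Local Open Scope ring_scope.

(* R^n, with the product sigma-algebra of the Borel sigma-algebra of R. *)
Notation Rn R n := (n.-tuple (measurableTypeR R)).

Section LebesgueRn.
Context {R : realType}.

Definition tcons n (u : Rn R n * measurableTypeR R) : Rn R n.+1 :=
  [tuple of u.2 :: u.1].

Lemma measurable_tcons n : measurable_fun setT (@tcons n).
Proof. exact: measurable_cons. Qed.

Section step.
Variables (n : nat) (mu : {measure set (Rn R n) -> \bar R}).

Definition lebesgue_step : set (Rn R n.+1) -> \bar R :=
  pushforward (mu \x (@lebesgue_measure R))%E (@tcons n).

Let step0 : lebesgue_step set0 = 0%E.
Proof. by rewrite /lebesgue_step /pushforward preimage_set0 measure0. Qed.

Let step_ge0 A : (0 <= lebesgue_step A)%E.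
Proof. by rewrite /lebesgue_step /pushforward measure_ge0. Qed.

Let step_sigma_additive : semi_sigma_additive lebesgue_step.
Proof.
move=> F mF tF mUF; rewrite /lebesgue_step /pushforward preimage_bigcup.
have mpre A : measurable A -> measurable (@tcons n @^-1` A).
  by move=> mA; rewrite -[X in measurable X]setTI; exact: measurable_tcons.
apply: measure_semi_sigma_additive.
- by move=> i; exact: mpre.
- by move=> i j _ _ [t [ti tj]]; apply: (tF i j I I); exists (tcons t).
- by rewrite -preimage_bigcup; exact: mpre.
Qed.

HB.instance Definition _ := isMeasure.Build _ _ _ lebesgue_step
  step0 step_ge0 step_sigma_additive.
End step.

(* Lebesgue measure on R^n as the iterated product of the one-dimensional one. *)
Fixpoint lebesgueRn n : {measure set (Rn R n) -> \bar R} :=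
  match n return {measure set (Rn R n) -> \bar R} with
  | 0 => dirac [tuple]
  | m.+1 => lebesgue_step (lebesgueRn m)
  end.

Lemma lebesgueRn_prod n (A : 'I_n -> set (measurableTypeR R)) :
  (forall i, measurable (A i)) ->
  lebesgueRn n [set t | forall i, A i (tnth t i)] =
  (\prod_(i < n) lebesgue_measure (A i))%E.
Proof.
elim: n A => [|n IH] A mA.
  by rewrite big_ord0 /= diracE mem_set// => -[].
rewrite big_ord_recl muleC -IH; last by move=> i; exact: mA.
rewrite -product_measure1E; last 2 first.
- rewrite (_ : [set _ | _] = \bigcap_(i in [set: 'I_n])
     ((fun t : Rn R n => tnth t i) @^-1` A (lift ord0 i))); last first.
    by apply/seteqP; split=> t /= h i; [move=> _; exact: h|exact: (h i I)].
  apply: fin_bigcap_measurable => // i _.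
  by rewrite -[X in measurable X]setTI; exact: measurable_tnth.
- exact: mA.
congr (product_measure1 _ _ _); apply/seteqP; split=> -[t x] /=.
  move=> h; split=> [i|]; last exact: (h ord0).
  by have := h (lift ord0 i); rewrite tnthS.
case=> h hx i.
by case: (unliftP ord0 i) => [j ->|->//]; rewrite tnthS; exact: h.
Qed.

End LebesgueRn.

(* The dimension of [mean_zero] below, for n >= 1. *)
Definition dimM (n : nat) : nat := ((n * n.+1)./2 - 1)%N.

Section EvenQuartics.
Context {R : realType} {n : nat}.

Definition even_quartic : set {mpoly R[n]} :=
  [set f | exists2 a : 'M[R]_n, a^T = a &
     f = \sum_i \sum_j a i j *: ('X_i ^+ 2 * 'X_j ^+ 2)].

Definition POS_Q : set {mpoly R[n]} :=
  [set f | even_quartic f /\ forall x : Rn R n, 0 <= f.@[tnth x]].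

Definition SOS_Q : set {mpoly R[n]} :=
  [set f | even_quartic f /\ exists2 s : seq {mpoly R[n]},
     {in s, forall g, g \is 2.-homog} & f = \sum_(g <- s) g ^+ 2].

Definition sphere : set (Rn R n) := [set x | \sum_(i < n) tnth x i ^+ 2 = 1].

Definition mxact (A : 'M[R]_n) (x : Rn R n) : Rn R n :=
  [tuple \sum_(j < n) A i j * tnth x j | i < n].

Definition rotation (A : 'M[R]_n) : Prop := A *m A^T = 1%:M /\ \det A = 1.

(* A probability measure on the sphere is encoded as a Borel probability measure
   on R^n that gives mass 1 to the sphere. *)
Definition rotation_invariant_on_sphere (sigma : probability (Rn R n) R) : Prop :=
  sigma sphere = 1%E /\
  forall (A : 'M[R]_n) (E : set (Rn R n)), rotation A -> measurable E ->
    sigma (mxact A @^-1` E) = sigma E.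

Section Volume.
Variable sigma : probability (Rn R n) R.

Definition sphere_int (f : {mpoly R[n]}) : R :=
  \int[sigma]_(x in sphere) f.@[tnth x].

Definition mean_zero : set {mpoly R[n]} :=
  [set f | even_quartic f /\ sphere_int f = 0].

Definition linear_isometry (phi : {linear 'rV[R]_(dimM n) -> {mpoly R[n]}}) : Prop :=
  phi @` setT = mean_zero /\
  forall u v : 'rV[R]_(dimM n),
    sphere_int (phi u * phi v) = \sum_(i < dimM n) u 0 i * v 0 i.

(* The pushforward of Lebesgue measure under [phi]; it does not depend on the
   choice of the isometry [phi]. *)
Definition Vol (phi : {linear 'rV[R]_(dimM n) -> {mpoly R[n]}})
    (C : set {mpoly R[n]}) : \bar R :=
  lebesgueRn (dimM n) [set t | C (phi (\row_i tnth t i))].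

Definition unit_ball : set {mpoly R[n]} :=
  [set f | mean_zero f /\ sphere_int (f * f) <= 1].

Definition vrad (phi : {linear 'rV[R]_(dimM n) -> {mpoly R[n]}})
    (C : set {mpoly R[n]}) : R :=
  (fine (Vol phi C) / fine (Vol phi unit_ball)) `^ ((dimM n)%:R^-1).

Definition POS_tilde : set {mpoly R[n]} :=
  [set f | mean_zero f /\ POS_Q (f + (\sum_i 'X_i ^+ 2) ^+ 2)].

Definition SOS_tilde : set {mpoly R[n]} :=
  [set f | mean_zero f /\ SOS_Q (f + (\sum_i 'X_i ^+ 2) ^+ 2)].

End Volume.

End EvenQuartics.

(* Main.v *)
(* An even quartic with matrix A is nonnegative iff A is copositive, and it is a
   sum of squares if A is positive semidefinite. Let K be the body POS~ and d its
   dimension. The sets K_z = {w | z + w and z - w lie in K} have volumes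
   integrating to 2^-d |K|^2 over z in K, so |K_z| >= 3^-d |K| for some z. By
   Prekopa-Leindler, |K_z| is log-concave in z; as it is invariant under
   permutations of the variables, z may be replaced by its average over them,
   whose matrix is a combination of the identity matrix I and the all-ones
   matrix. Then for w in K_z the quadratic form W of w satisfies
   |W(x)| <= (n + 2) |x|^2 for x >= 0, hence |W(y)| <= 3 (n + 2) |y|^2 for all y,
   by the parallelogram law applied to the positive and negative parts of y. So
   W / 9 + (n + 2) / 3 I is positive semidefinite, which puts a translate of
   K_z / 9 into SOS~. Thus |SOS~| >= 27^-d |POS~|. *)

(* The average over permutations keeps the constant independent of [n]. A copositive [A] with
   [lform A = n (n + 2)] can have a single nonzero entry [n (n + 2) / 3], on the diagonal, and its
   form then reaches [n (n + 2) / 3 |x|^2]. Invariance under permutations leaves two parameters, and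
   the bound drops to [(n + 2) |x|^2]. Symmetric parts are taken because copositivity bounds a form
   from one side only, while the parallelogram law wants both sides.

   The numbers: [lform] must vanish on the translation vector, which forces the multiple
   [(n + 2) / 3] of [I]; 9 is the quotient of [3 (n + 2)] by it, and [27 = 3 * 9] is less than
   [2^8 * 3^2].

   Permutations preserve volume by uniqueness of Haar measure, since they map [K], of positive
   finite volume, to itself; no determinant is computed. Prekopa-Leindler is proved for the weights
   [m / (m + 1)] and [1 / (m + 1)]: these suffice to average points one by one, and they keep the
   exponents integral. *)
Require Import Defs.
From HB Require Import structures.
From mathcomp Require Import all_boot all_order all_algebra all_fingroup.
From mathcomp.multinomials Require Import mpoly.
From mathcomp Require Import all_classical all_reals all_analysis measurable_realfun.
From mathcomp Require Import ring lra.

Import Order.TTheory GRing.Theory Num.Theory.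
Local Open Scope classical_set_scope.
Local Open Scope ring_scope.

Set Implicit Arguments.
Unset Strict Implicit.
Unset Printing Implicit Defensive.

(** * Lebesgue measure *)

Section Preimage.
Context d1 d2 (T1 : measurableType d1) (T2 : measurableType d2) (R : realType).
Variables (mu : {measure set T1 -> \bar R}) (f : T1 -> T2).
Hypothesis mf : measurable_fun setT f.

Definition image_measure : {measure set T2 -> \bar R} :=
  measure_function_pushforward__canonical__measure_function_Measure mu mf.

Lemma ge0_integral_image_measure (g : T2 -> \bar R) : measurable_fun setT g ->
  (forall y, (0 <= g y)%E) ->
  (\int[image_measure]_y g y = \int[mu]_x g (f x))%E.
Proof.
by move=> mg g0; rewrite [LHS](ge0_integral_pushforward mf).
Qed.

End Preimage.

Section Lebesgue1.
Context {R : realType}.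
Notation leb := (@lebesgue_measure R).

Lemma measurable_affine (c b : R) :
  measurable_fun [set: measurableTypeR R]
    (fun x : measurableTypeR R => c * x + b : measurableTypeR R).
Proof.
apply: (@measurable_funD _ (measurableTypeR R) R setT (fun x => c * x) (cst b)).
  exact: mulrl_measurable.
exact: measurable_cst.
Qed.

(** The image of Lebesgue measure under the affine map, times [|c|], agrees with Lebesgue measure on
    half-open intervals, hence on Borel sets. For [c < 0] the preimage of such an interval is closed
    at the other end. *)
Lemma lebesgue_affine (c b : R) (A : set (measurableTypeR R)) : c != 0 ->
  measurable A ->
  leb [set x : measurableTypeR R | A (c * x + b)] = ((`|c|^-1)%:E * leb A)%E.
Proof.
move=> c0 mA.
have c_gt0 : 0 < `|c| by rewrite normr_gt0.
suff -> : leb A = (`|c|%:E * leb [set x | A (c * x + b)%R])%E.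
  by rewrite muleA -EFinM mulVf ?mul1e// gt_eqF.
pose mu : {measure set _ -> \bar R} :=
  mscale (NngNum (normr_ge0 c)) (image_measure leb (measurable_affine c b)).
apply: (lebesgue_measure_unique (mu := mu)) => //= _ [[u v] _ <-]/=.
rewrite lebesgue_measure_itv /= lte_fin.
rewrite /mscale /= /image_measure /= /pushforward.
rewrite (_ : _ @^-1` _ = if 0 < c then `](u - b) / c, (v - b) / c]%classic
    else `[(v - b) / c, (u - b) / c[%classic); last first.
  apply/seteqP; case: ifP => c0' ; split=> x /=; rewrite !in_itv /=.
  - by rewrite ltr_pdivrMr// ler_pdivlMr// (mulrC x) ltrBlDr lerBrDr.
  - by rewrite ltr_pdivrMr// ler_pdivlMr// (mulrC x) ltrBlDr lerBrDr.
  - have {}c0' : c < 0 by rewrite lt_neqAle c0 leNgt c0'.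
    by rewrite ler_ndivrMr// ltr_ndivlMr// (mulrC x) ltrBlDr lerBrDr andbC.
  - have {}c0' : c < 0 by rewrite lt_neqAle c0 leNgt c0'.
    by rewrite ler_ndivrMr// ltr_ndivlMr// (mulrC x) ltrBlDr lerBrDr andbC.
have [c0'|c0'] := boolP (0 < c); rewrite lebesgue_measure_itv /= lte_fin.
  rewrite ltr_pM2r ?invr_gt0// ltrD2r; case: ifP => _; last by rewrite mule0.
  rewrite -!EFinD -EFinM gtr0_norm//; congr (_%:E); field.
  exact: c0.
have {}c0' : c < 0 by rewrite lt_neqAle c0 leNgt.
rewrite ltr_nM2r ?invr_lt0// ltrD2r; case: ifP => _; last by rewrite mule0.
rewrite -!EFinD -EFinM ltr0_norm//; congr (_%:E); field.
exact: c0.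
Qed.

(** Holds for all sets because [lebesgue_measure] is given by an outer measure. *)
Lemma lebesgue_monotone (A B : set (measurableTypeR R)) : A `<=` B ->
  (leb A <= leb B)%E.
Proof. by move=> AB; rewrite /lebesgue_measure /lebesgue_stieltjes_measure /measure_extension; apply: le_mu_ext. Qed.

End Lebesgue1.

Section IntegralMonotone.
Context d (T : measurableType d) (R : realType).
Variable mu : {measure set T -> \bar R}.

(** The integral of a nonnegative function is a supremum over the simple functions below it, whether
    or not the function is measurable. *)
Lemma ge0_integral_monotone (f g : T -> \bar R) :
  (forall x, 0 <= f x)%E -> (forall x, f x <= g x)%E ->
  (\int[mu]_x f x <= \int[mu]_x g x)%E.
Proof.
move=> f0 fg; have g0 x : (0 <= g x)%E := le_trans (f0 x) (fg x).
rewrite !ge0_integralTE//; apply: ereal_sup_le => _ [h hf <-].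
by exists h => // x; exact: le_trans (hf x) (fg x).
Qed.

End IntegralMonotone.

Section LebesgueRnTheory.
Context {R : realType}.
Notation leb := (@lebesgue_measure R).

(** An unfolding of the definitions, hence available for sets that are not Borel. *)
Lemma lebesgueRnS n (A : set (Rn R n.+1)) :
  lebesgueRn n.+1 A =
  (\int[lebesgueRn n]_u leb [set x | A (tcons (u, x))])%E.
Proof.
rewrite /= /lebesgue_step /pushforward /product_measure1.
apply: eq_integral => u _ /=; congr (leb _); apply/seteqP; split=> x /=.
  by rewrite /xsection /= inE.
by rewrite /xsection /= inE.
Qed.

(* For arbitrary sets: [SOS_tilde] is never shown to be Borel. *)
Lemma lebesgueRn_monotone n (A B : set (Rn R n)) : A `<=` B ->
  (lebesgueRn n A <= lebesgueRn n B)%E.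
Proof.
elim: n A B => [|n IH] A B AB.
  rewrite /= /dirac !indicE lee_fin ler_nat.
  by case: (boolP ([tuple] \in A)) => // /set_mem/AB /mem_set ->.
rewrite !lebesgueRnS; apply: ge0_integral_monotone => u.
  exact: measure_ge0.
by apply: lebesgue_monotone => x; exact: AB.
Qed.

Lemma measurable_tcons_slice n (A : set (Rn R n.+1)) (u : Rn R n) :
  measurable A -> measurable [set x : measurableTypeR R | A (tcons (u, x))].
Proof.
move=> mA; have := measurable_xsection u (measurable_tcons (n := n) measurableT mA).
congr (measurable _); rewrite setTI; apply/seteqP; split=> x /=.
  by rewrite /xsection /= inE.
by rewrite /xsection /= inE.
Qed.

Lemma measurable_fun_slice n (A : set (Rn R n.+1)) : measurable A ->
  measurable_fun setT (fun u : Rn R n => leb [set x | A (tcons (u, x))]).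
Proof.
move=> mA.
have := measurable_fun_xsection leb (measurable_tcons (n := n) measurableT mA).
congr (measurable_fun _ _); apply/funext => u /=; rewrite setTI; congr (leb _).
by apply/seteqP; split=> x /=; rewrite /xsection /= inE.
Qed.

Lemma sigma_finite_lebesgueRn n : sigma_finite setT (@lebesgueRn R n).
Proof.
pose cube (k : nat) : set (Rn R n) :=
  [set t | forall i : 'I_n, `[(- k%:R)%R, k%:R]%classic (tnth t i)].
exists cube.
  apply/seteqP; split=> // t _; pose M := \big[Num.max/0]_(i < n) `|tnth t i|.
  exists (Num.truncn M).+1 => // i /=; rewrite in_itv /= -ler_norml.
  apply: le_trans (ltW (truncnS_gt M)).
  exact: (le_bigmax _ (fun i => `|tnth t i|)).
move=> k; split.
  rewrite (_ : cube k = \bigcap_(i in [set: 'I_n])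
     ((fun t : Rn R n => tnth t i) @^-1` `[(- k%:R)%R, k%:R]%classic)).
    apply: fin_bigcap_measurable => // i _.
    by rewrite -[X in measurable X]setTI; exact: measurable_tnth.
  by apply/seteqP; split=> t /= h i; [move=> _; exact: h|exact: (h i I)].
rewrite /cube (lebesgueRn_prod (A := fun=> `[(- k%:R)%R, k%:R]%classic))//.
rewrite big_const; elim: #|_| => [|m IHm] /=; first by rewrite ltry.
by rewrite lte_mul_pinfty// lebesgue_measure_itv /=; case: ifP => //; rewrite ?ltry.
Qed.

(* A copy of [lebesgueRn], which as the projection of a bundled measure cannot
   itself be declared sigma-finite. *)
Definition lebRn n : set (Rn R n) -> \bar R := lebesgueRn n.
HB.instance Definition _ n := Measure.copy (@lebRn n) (lebesgueRn n).
HB.instance Definition _ n :=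
  @Measure_isSigmaFinite.Build _ _ _ (@lebRn n) (@sigma_finite_lebesgueRn n).

Lemma integral_lebesgueRnS n (f : Rn R n.+1 -> \bar R) :
  measurable_fun setT f -> (forall t, 0 <= f t)%E ->
  (\int[lebesgueRn n.+1]_t f t =
   \int[lebesgueRn n]_u \int[leb]_x f (tcons (u, x)))%E.
Proof.
move=> mf f0.
have := ge0_integral_image_measure (lebesgueRn n \x leb)%E
  (measurable_tcons (n := n)) mf f0.
rewrite -[X in X = _ -> _]/(\int[lebesgueRn n.+1]_t f t)%E => ->.
rewrite [LHS](fubini_tonelli1 (m1 := @lebRn n)
  (fun z => f (tcons z)))//.
exact: measurableT_comp mf (measurable_tcons (n := n)).
Qed.

Lemma integral_lebesgueRn_swap m n (f : Rn R m * Rn R n -> \bar R) :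
  measurable_fun setT f -> (forall t, 0 <= f t)%E ->
  (\int[lebesgueRn m]_u \int[lebesgueRn n]_v f (u, v) =
   \int[lebesgueRn n]_v \int[lebesgueRn m]_u f (u, v))%E.
Proof. 
by move=> mf f0; exact: (fubini_tonelli (m1 := @lebRn m)
  (m2 := @lebRn n)). Qed.

End LebesgueRnTheory.

(** * Affine changes of variables *)

Section Scaling.
Context d (T : measurableType d) (R : realType).
Variables (mu : {measure set T -> \bar R}) (f : T -> T) (k : R).
Hypotheses (mf : measurable_fun setT f) (k0 : 0 <= k).
Hypothesis mu_f : forall A, measurable A -> mu (f @^-1` A) = (k%:E * mu A)%E.

Lemma ge0_integral_scaling (g : T -> \bar R) : measurable_fun setT g ->
  (forall y, (0 <= g y)%E) ->
  (\int[mu]_x g (f x) = k%:E * \int[mu]_y g y)%E.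
Proof.
move=> mg g0; rewrite -(ge0_integral_image_measure mu mf mg g0).
rewrite -(@ge0_integral_mscale _ _ _ mu setT measurableT (NngNum k0) g mg)//.
by apply: eq_measure_integral => A mA _; exact: mu_f.
Qed.

End Scaling.

Section Affine.
Context {R : realType}.
Notation leb := (@lebesgue_measure R).

Definition raff n (c : R) (b t : Rn R n) : Rn R n :=
  [tuple c * tnth t i + tnth b i | i < n].

Lemma tnth_raff n c (b t : Rn R n) i :
  tnth (raff c b t) i = c * tnth t i + tnth b i.
Proof. by rewrite tnth_mktuple. Qed.

Lemma measurable_raff n c (b : Rn R n) : measurable_fun setT (raff c b).
Proof.
apply/measurable_fun_tnthP => i.
rewrite (_ : _ \o _ = (fun x => c * x + tnth b i) \o (fun t => tnth t i)).
  apply: measurableT_comp; [exact: measurable_affine|exact: measurable_tnth].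
by apply/funext => t /=; rewrite tnth_raff.
Qed.

Lemma raff_tcons n c (b u : Rn R n) (y x : R) :
  raff c (tcons (b, y)) (tcons (u, x)) = tcons (raff c b u, c * x + y).
Proof.
apply: eq_from_tnth => i; rewrite tnth_raff.
by case: (unliftP ord0 i) => [j ->|->]; rewrite ?tnthS ?tnth_raff ?tnth0.
Qed.

Lemma tcons_surj n (b : Rn R n.+1) : exists b' y, b = tcons (b', y).
Proof.
by exists [tuple of behead b], (thead b); rewrite [LHS]tuple_eta; exact: val_inj.
Qed.

(** Each coordinate contributes a factor [1 / |c|]: the one integrated first by [lebesgue_affine],
    the others by the induction hypothesis, fed to [ge0_integral_scaling]. *)
Lemma lebesgueRn_affine n c (b : Rn R n) (A : set (Rn R n)) : c != 0 ->
  measurable A ->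
  lebesgueRn n [set t | A (raff c b t)] =
  ((`|c|^-1 ^+ n)%:E * lebesgueRn n A)%E.
Proof.
move=> c0; have kn0 m : 0 <= `|c|^-1 ^+ m by rewrite exprn_ge0.
elim: n b A => [|n IH] b A mA.
  rewrite expr0 mul1e; congr (lebesgueRn 0 _); apply/seteqP.
  by split=> t /=; rewrite (tuple0 (raff _ _ _)) (tuple0 t).
rewrite !lebesgueRnS; have [b' [y ->]] := tcons_surj b.
under eq_integral => u _.
  rewrite (_ : [set x | _] = [set x : measurableTypeR R |
    [set z | A (tcons (raff c b' u, z))] (c * x + y)]); last first.
    by apply/seteqP; split=> x /=; rewrite raff_tcons.
  rewrite (lebesgue_affine y c0 (measurable_tcons_slice (raff c b' u) mA)).
  over.
have msl := measurable_fun_slice mA.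
rewrite ge0_integralZl//; last exact: measurableT_comp msl (measurable_raff c b').
rewrite (ge0_integral_scaling (measurable_raff c b') (kn0 n) _ msl).
- by rewrite muleA -EFinM exprS.
- by move=> B mB; exact: IH.
- by move=> u; exact: measure_ge0.
Qed.

Lemma ge0_integral_lebesgueRn_affine n c (b : Rn R n) (g : Rn R n -> \bar R) :
  c != 0 -> measurable_fun setT g -> (forall t, (0 <= g t)%E) ->
  (\int[lebesgueRn n]_t g (raff c b t) =
   (`|c|^-1 ^+ n)%:E * \int[lebesgueRn n]_t g t)%E.
Proof.
move=> c0 mg g0; apply: ge0_integral_scaling => //.
- exact: measurable_raff.
- by move=> A mA; exact: lebesgueRn_affine.
Qed.

Lemma lebesgueRn_box n (a b : R) : a <= b ->
  lebesgueRn n [set t | forall i : 'I_n, `[a, b]%classic (tnth t i)] =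
  ((b - a) ^+ n)%:E.
Proof.
move=> ab; rewrite (lebesgueRn_prod (A := fun=> `[a, b]%classic)); last first.
  by move=> _; exact: measurable_itv.
rewrite (eq_bigr (fun=> (b - a)%:E)); last first.
  move=> _ _; rewrite lebesgue_measure_itv /= lte_fin -EFinB.
  by case: ltgtP ab => // -> _; rewrite subrr.
by rewrite prodEFin prodr_const card_ord.
Qed.

Lemma lebesgueRn_bounded n (A : set (Rn R n)) (r : R) :
  (forall t, A t -> forall i, `|tnth t i| <= r) -> (lebesgueRn n A < +oo)%E.
Proof.
(* [r] may be negative, for instance when [A] is empty, but [lebesgueRn_box] needs ordered end
   points. *)
move=> Ar; set r' := Num.max r 0.
have r'0 : - r' <= r' by rewrite -subr_ge0 opprK addr_ge0// le_max lexx orbT.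
apply: (@le_lt_trans _ _ ((r' - - r') ^+ n)%:E); last by rewrite ltry.
rewrite -(lebesgueRn_box n r'0); apply: lebesgueRn_monotone => t At i /=.
by rewrite in_itv /= -ler_norml le_max Ar.
Qed.

Lemma lebesgueRn_gt0 n (A : set (Rn R n)) (r : R) : 0 < r ->
  (forall t, (forall i, `|tnth t i| <= r) -> A t) -> (0 < lebesgueRn n A)%E.
Proof.
move=> r0 Ar; have r1 : - r <= r by rewrite -subr_ge0 opprK addr_ge0// ltW.
apply: (@lt_le_trans _ _ ((r - - r) ^+ n)%:E).
  by rewrite lte_fin exprn_gt0// opprK addr_gt0.
rewrite -(lebesgueRn_box n r1); apply: lebesgueRn_monotone => t At.
by apply: Ar => i; have := At i; rewrite /= in_itv /= -ler_norml.
Qed.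

End Affine.

(** * Uniqueness of Haar measure and symmetric parts *)

Section Haar.
Context {R : realType} {n : nat}.
Implicit Types (A B K : set (Rn R n)) (b t u v w z : Rn R n).

Definition rzero : Rn R n := [tuple 0 | i < n].
(** Sums, reflections and scalings are instances of [raff], whose lemmas on measurability and volume
    cover them all. *)
Definition radd b t := raff 1 b t.
Definition rsub b t := raff (- 1) b t.
Definition rscale (c : R) t := raff c rzero t.

Lemma tnth_radd b t i : tnth (radd b t) i = tnth b i + tnth t i.
Proof. by rewrite tnth_raff mul1r addrC. Qed.

Lemma tnth_rsub b t i : tnth (rsub b t) i = tnth b i - tnth t i.
Proof. by rewrite tnth_raff mulN1r addrC. Qed.

Lemma measurable_raff2 d (T : measurableType d) (c : R) (f g : T -> Rn R n) :
  measurable_fun setT f -> measurable_fun setT g ->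
  measurable_fun setT (fun p => raff c (f p) (g p)).
Proof.
move=> mf mg; apply/measurable_fun_tnthP => i.
rewrite (_ : _ \o _ = (fun p => c * tnth (g p) i) \+ (fun p => tnth (f p) i)).
  apply: (@measurable_funD _ T R setT).
    apply: (measurableT_comp (mulrl_measurable (D := setT) c)).
    exact: measurableT_comp (measurable_tnth i) mg.
  exact: measurableT_comp (measurable_tnth i) mf.
by apply/funext => p /=; rewrite tnth_raff.
Qed.

Lemma measurable_indic_comp d (T : measurableType d) (f : T -> Rn R n) A :
  measurable A -> measurable_fun setT f ->
  measurable_fun setT (fun p => (\1_A (f p))%:E : \bar R).
Proof.
move=> mA mf; apply/measurable_EFinP.
exact: measurableT_comp (measurable_indic mA) mf.
Qed.

Lemma integral_indic_affine c b A : c != 0 -> measurable A ->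
  (\int[lebesgueRn n]_t (\1_A (raff c b t))%:E =
   (`|c|^-1 ^+ n)%:E * lebesgueRn n A)%E.
Proof.
move=> c0 mA.
rewrite (ge0_integral_lebesgueRn_affine b c0 (measurable_indic_comp mA (@measurable_id _ _ setT)))//.
by rewrite integral_indic// setIT.
Qed.

Lemma raff_rsub b t : raff 1 (raff (- 1) rzero t) b = rsub b t.
Proof.
by apply: eq_from_tnth => i; rewrite !tnth_raff tnth_mktuple; ring.
Qed.

Lemma rsubK b : involutive (rsub b).
Proof. by move=> t; apply: eq_from_tnth => i; rewrite !tnth_rsub subKr. Qed.

Lemma ge0_integral_lebesgueRn_rsub b (g : Rn R n -> \bar R) :
  measurable_fun setT g -> (forall t, (0 <= g t)%E) ->
  (\int[lebesgueRn n]_t g (rsub b t) = \int[lebesgueRn n]_t g t)%E.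
Proof.
move=> mg g0; rewrite ge0_integral_lebesgueRn_affine ?oppr_eq0 ?oner_eq0//.
by rewrite normrN normr1 invr1 expr1n mul1e.
Qed.

Section LinearInvariance.
Variables (T T' : Rn R n -> Rn R n).
Hypotheses (mT : measurable_fun setT T) (TT' : cancel T' T).
Hypothesis TB : forall b t, T (rsub b t) = rsub (T b) (T t).

(* Uniqueness of Haar measure: integrating [1_A(Tx) 1_B(y - Tx)] in both orders
   gives |T^-1 A| |B| = |T^-1 B| |A|. *)
Lemma lebesgueRn_linear_ratio A B : measurable A -> measurable B ->
  (lebesgueRn n (T @^-1` A) * lebesgueRn n B =
   lebesgueRn n (T @^-1` B) * lebesgueRn n A)%E.
Proof.
move=> mA mB.
have mTX X : measurable X -> measurable (T @^-1` X).
  by move=> mX; rewrite -[X in measurable X]setTI; exact: mT.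
have msub : measurable_fun setT (fun p : Rn R n * Rn R n => rsub p.2 (T p.1)).
  by apply: measurable_raff2 => //; exact: measurableT_comp mT measurable_fst.
have E X Y : measurable X -> measurable Y ->
  (\int[lebesgueRn n]_x \int[lebesgueRn n]_y
     ((\1_X (T x))%:E * (\1_Y (rsub y (T x)))%:E) =
   lebesgueRn n (T @^-1` X) * lebesgueRn n Y)%E.
  move=> mX mY.
  under eq_integral => x _.
    rewrite ge0_integralZl//; last first.
      apply: measurable_indic_comp mY _.
      exact: measurableT_comp msub (measurable_pair1 x).
    under eq_integral do rewrite -raff_rsub.
    rewrite integral_indic_affine ?oner_eq0// normr1 invr1 expr1n mul1e muleC.
    over.
  rewrite ge0_integralZl//; last exact: measurable_indic_comp mX mT.
  rewrite muleC; congr (_ * _)%E.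
  rewrite -[in RHS](setIT (T @^-1` X)) -integral_indic//; exact: mTX.
have m2 X Y : measurable X -> measurable Y ->
    measurable_fun setT (fun p : Rn R n * Rn R n =>
      (\1_X (T p.1))%:E * (\1_Y (rsub p.2 (T p.1)))%:E : \bar R)%E.
  move=> mX mY; apply: emeasurable_funM; apply: measurable_indic_comp => //.
  exact: measurableT_comp mT measurable_fst.
rewrite -(E A B mA mB) -(E B A mB mA).
rewrite (integral_lebesgueRn_swap (m2 A B mA mB)); last first.
  by move=> p; rewrite -EFinM lee_fin mulr_ge0.
rewrite (integral_lebesgueRn_swap (m2 B A mB mA)); last first.
  by move=> p; rewrite -EFinM lee_fin mulr_ge0.
apply: eq_integral => y _ /=.
pose g x : \bar R := ((\1_A (T x))%:E * (\1_B (rsub y (T x)))%:E)%E.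
have mg : measurable_fun setT g.
  exact: measurableT_comp (m2 A B mA mB) (measurable_pair2 y).
have g0 x : (0 <= g x)%E by rewrite /g -EFinM lee_fin mulr_ge0.
(* The reflection [x -> T' y - x] exchanges [T x] and [y - T x], and with them the arguments of the
   two indicators. *)
transitivity (\int[lebesgueRn n]_x g (rsub (T' y) x))%E.
  by rewrite ge0_integral_lebesgueRn_rsub.
by apply: eq_integral => x _; rewrite /g TB TT' rsubK muleC.
Qed.

(** Taking [B = K] in [lebesgueRn_linear_ratio] shows that the factor by which [T] scales volumes is
    1. *)
Lemma lebesgueRn_linear_invariant K : measurable K -> T @^-1` K = K ->
  (0 < lebesgueRn n K < +oo)%E ->
  forall A, measurable A -> lebesgueRn n (T @^-1` A) = lebesgueRn n A.
Proof.
move=> mK TK /andP[K0 Koo] A mA; have := lebesgueRn_linear_ratio mA mK.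
rewrite TK [RHS]muleC => eqAK.
have Kfin : lebesgueRn n K \is a fin_num by rewrite ge0_fin_numE// ltW.
by apply/eqP; rewrite eq_le; apply/andP; split;
  rewrite -(lee_pmul2r Kfin K0) eqAK.
Qed.

End LinearInvariance.

(** [K_z] of the overview: the intersection of [K - z] and [z - K]. *)
Definition sym_part K z : set (Rn R n) :=
  [set w | K (radd z w) /\ K (rsub z w)].

Lemma measurable_sym_part K z : measurable K -> measurable (sym_part K z).
Proof.
move=> mK; apply: measurableI; rewrite -[X in measurable X]setTI.
  exact: (measurable_raff 1 z measurableT mK).
exact: (measurable_raff (- 1) z measurableT mK).
Qed.

(** The substitution [v = z - w] turns [z + w] into [2 z - v]. For fixed [v] this is an affine map
    of ratio 2 in [z], the origin of the [2^-n] in [integral_sym_part]. *)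
Lemma lebesgueRn_sym_partE K z : measurable K ->
  (lebesgueRn n (sym_part K z) =
   \int[lebesgueRn n]_v ((\1_K v)%:E * (\1_K (raff 2 (rsub rzero v) z))%:E))%E.
Proof.
move=> mK; have mS := measurable_sym_part z mK.
transitivity (lebesgueRn n [set v | sym_part K z (rsub z v)]).
  rewrite [RHS]lebesgueRn_affine ?oppr_eq0 ?oner_eq0//.
  by rewrite normrN normr1 invr1 expr1n mul1e.
have mS' : measurable [set v | sym_part K z (rsub z v)].
  by rewrite -[X in measurable X]setTI; exact: (measurable_raff (- 1) z measurableT mS).
rewrite -[in LHS](setIT [set _ | _]) -integral_indic//.
apply: eq_integral => v _; rewrite -EFinM; congr (_%:E).
rewrite !indicE /= -natrM mulnb; congr (nat_of_bool _)%:R.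
have e1 : radd z (rsub z v) = raff 2 (rsub rzero v) z.
  apply: eq_from_tnth => i; rewrite !tnth_raff tnth_mktuple; ring.
apply/idP/andP => [/set_mem/= [] | [/set_mem Kv /set_mem Kz]].
  by rewrite e1 rsubK => Kz Kv; split; exact: mem_set.
by apply/mem_set; rewrite /= /sym_part /= e1 rsubK.
Qed.

Lemma integral_sym_part K : measurable K ->
  (\int[lebesgueRn n]_z lebesgueRn n (sym_part K z) =
   (2^-1 ^+ n)%:E * (lebesgueRn n K * lebesgueRn n K))%E.
Proof.
move=> mK; under eq_integral do rewrite lebesgueRn_sym_partE//.
have mraff : measurable_fun setT
    (fun p : Rn R n * Rn R n => raff 2 (rsub rzero p.2) p.1).
  by apply: measurable_raff2 => //; exact: measurableT_comp (measurable_raff _ _) measurable_snd.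
have m2 : measurable_fun setT (fun p : Rn R n * Rn R n =>
    (\1_K p.2)%:E * (\1_K (raff 2 (rsub rzero p.2) p.1))%:E : \bar R)%E.
  by apply: emeasurable_funM; apply: measurable_indic_comp.
rewrite (integral_lebesgueRn_swap m2); last first.
  by move=> p; rewrite -EFinM lee_fin mulr_ge0.
under eq_integral => v _.
  rewrite /= ge0_integralZl//; last first.
    by apply: measurable_indic_comp mK _; exact: measurable_raff.
  rewrite integral_indic_affine ?pnatr_eq0// ger0_norm// muleC.
  over.
rewrite ge0_integralZl//.
- by rewrite integral_indic// setIT muleA.
- by apply: measurable_indic_comp mK _; exact: measurable_id.
Qed.

(* [|sym_part K z|] vanishes for [z] outside [K] and integrates to [2^-n |K|^2]. *)
Lemma large_sym_part K : (0 < n)%N -> measurable K ->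
  (0 < lebesgueRn n K < +oo)%E ->
  (forall z w, K (radd z w) -> K (rsub z w) -> K z) ->
  exists z, ((3^-1 ^+ n)%:E * lebesgueRn n K <= lebesgueRn n (sym_part K z))%E.
Proof.
move=> n0 mK /andP[K0 Koo] Kmid; apply: contrapT => /forallNP noz.
have Kfin : lebesgueRn n K \is a fin_num by rewrite ge0_fin_numE// ltW.
have le_ind z : (lebesgueRn n (sym_part K z) <=
    (3^-1 ^+ n)%:E * lebesgueRn n K * (\1_K z)%:E)%E.
  have [Kz|nKz] := pselect (K z).
    rewrite indicE mem_set// mule1 ltW// ltNge; exact/negP/noz.
  rewrite (_ : sym_part K z = set0) ?measure0.
    by rewrite indicE memNset// mule0.
  by apply/seteqP; split => // w [? ?]; exact/nKz/(Kmid z w).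
have : (\int[lebesgueRn n]_z lebesgueRn n (sym_part K z) <=
        \int[lebesgueRn n]_z ((3^-1 ^+ n)%:E * lebesgueRn n K * (\1_K z)%:E))%E.
  by apply: ge0_integral_monotone => // z; exact: measure_ge0.
rewrite integral_sym_part// ge0_integralZl//; last first.
  by apply: measurable_indic_comp mK _; exact: measurable_id.
rewrite integral_indic// setIT -muleA lee_pmul2r ?mule_gt0// ?fin_numM//.
(* What remains is [2^-n <= 3^-n], which fails as [n > 0]. With 3 in place of 2, a non-strict
   comparison of integrals is enough for the contradiction. *)
rewrite lee_fin leNgt => /negP; apply.
by rewrite ltrXn2r -?lt0n// ltf_pV2 ?posrE// ltr_nat.
Qed.

End Haar.

(** * The Prekopa-Leindler inequality *)

Section PrekopaLeindler1.
Context {R : realType}.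
Notation leb := (@lebesgue_measure R).
Notation RB := (measurableTypeR R).

(** The inequality of arithmetic and geometric means for [m] copies of [p] and one [q]. *)
Lemma weighted_AGM (m : nat) (p q : R) : 0 <= p -> 0 <= q ->
  p ^+ m * q <= ((m%:R * p + q) / m.+1%:R) ^+ m.+1.
Proof.
move=> p0 q0.
pose E (i : 'I_m.+1) := if i == ord0 then q else p.
have := @leif_AGM R 'I_m.+1 predT E; rewrite card_ord => -[|+ _].
  by move=> i _; rewrite /E; case: ifP.
rewrite !big_mkcond /= !big_ord_recl /E /=.
by rewrite prodr_const sumr_const !card_ord mulrC -[p *+ m]mulr_natl addrC.
Qed.

(** Cut off to 0 for negative [t], so that the layer cake formula can integrate over the whole
    line. *)
Definition level (f : RB -> R) (t : RB) : \bar R :=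
  if 0 <= t then leb [set x | t < f x] else 0%E.

Let hypograph (f : RB -> R) : set (RB * RB) := [set z | 0 <= z.2 /\ z.2 < f z.1].

Let measurable_hypograph (f : RB -> R) : measurable_fun setT f ->
  measurable_fun setT (fun z : RB * RB => (\1_(hypograph f) z)%:E : \bar R).
Proof.
move=> mf; suff mS : measurable (hypograph f).
  by apply/measurable_EFinP; exact: measurable_indic.
rewrite (_ : hypograph f = (fun z : RB * RB => 0 <= z.2) @^-1` [set true] `&`
    (fun z => z.2 < f z.1) @^-1` [set true]); last first.
  by apply/seteqP; split => z /= [].
apply: measurableI.
  have : measurable_fun setT (fun z : RB * RB => 0 <= z.2).
    exact: (@measurable_fun_ler _ _ R setT (cst 0) snd).
  by move=> /(_ measurableT [set true]); rewrite setTI; exact.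
have : measurable_fun setT (fun z : RB * RB => z.2 < f z.1).
  apply: (@measurable_fun_ltr _ _ R setT snd (f \o fst)) => //.
  exact: measurableT_comp mf measurable_fst.
by move=> /(_ measurableT [set true]); rewrite setTI; exact.
Qed.

Lemma measurable_superlevel (f : RB -> R) t : measurable_fun setT f ->
  measurable [set x | t < f x].
Proof.
move=> mf; have : measurable_fun setT (fun x : RB => t < f x).
  exact: (@measurable_fun_ltr _ _ R setT (cst t) f).
by move=> /(_ measurableT [set true]); rewrite setTI; exact.
Qed.

Let levelE (f : RB -> R) : measurable_fun setT f ->
  level f = fun t => (\int[leb]_x (\1_(hypograph f) (x, t))%:E)%E.
Proof.
move=> mf; apply/funext => t; rewrite /level; case: ifP => t0; last first.
  apply/esym/integral0_eq => x _; rewrite indicE memNset// /hypograph /= t0.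
  by case.
transitivity (leb ([set x : RB | t < f x] `&` setT)); first by rewrite setIT.
rewrite -integral_indic//; last exact: measurable_superlevel.
apply: eq_integral => x _; rewrite !indicE; congr (nat_of_bool _)%:R%:E.
by apply/idP/idP => /set_mem h; apply/mem_set => //; case: h.
Qed.

Lemma measurable_level (f : RB -> R) : measurable_fun setT f ->
  measurable_fun setT (level f).
Proof.
move=> mf; rewrite levelE//.
apply: (measurable_fun_fubini_tonelli_G (m1 := leb) _ (measurable_hypograph mf)).
by move=> z; rewrite lee_fin.
Qed.

(** Both sides are the area of the hypograph, by Tonelli. *)
Lemma layer_cake (f : RB -> R) : measurable_fun setT f -> (forall x, 0 <= f x) ->
  (\int[leb]_x (f x)%:E = \int[leb]_t level f t)%E.
Proof.
move=> mf f0.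
transitivity (\int[leb]_x \int[leb]_t (\1_(hypograph f) (x, t))%:E)%E.
  apply: eq_integral => x _.
  rewrite (_ : (fun t => _) = fun t : RB => (\1_`[0%R, f x[%classic t)%:E).
    rewrite integral_indic// setIT [RHS]/= lebesgue_measure_itv /= lte_fin oppr0 adde0.
    by have := f0 x; rewrite le_eqVlt => /predU1P[<-|->]; rewrite ?ltxx.
  apply/funext => t; rewrite !indicE; congr (nat_of_bool _)%:R%:E.
  apply/idP/idP => /set_mem h; apply/mem_set; move: h; rewrite /hypograph /= in_itv /=.
    by move=> [-> ->].
  by move=> /andP.
rewrite (levelE mf).
by apply: (fubini_tonelli (m1 := leb) (m2 := leb) _ (measurable_hypograph mf)) => z.
Qed.

Lemma brunn_minkowski1 (m : nat) (A B C : set RB) (r : R) : (0 < m)%N ->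
  measurable A -> measurable B -> measurable C -> A !=set0 -> B !=set0 ->
  (forall x, A x -> `|x| <= r) -> (forall x, B x -> `|x| <= r) ->
  (forall x y, A x -> B y -> C ((m%:R * x + y) / m.+1%:R)) ->
  (m%:R%:E * leb A + leb B <= m.+1%:R%:E * leb C)%E.
Proof.
move=> m0 mA mB mC A0 B0 Ar Br ABC.
have m_gt0 : 0 < m%:R :> R by rewrite ltr0n.
have m1_gt0 : 0 < m.+1%:R :> R by rewrite ltr0n.
have m_neq0 := lt0r_neq0 m_gt0; have m1_neq0 := lt0r_neq0 m1_gt0.
have supA : has_sup A by split=> //; exists r => x /Ar; rewrite ler_norml => /andP[].
have infB : has_inf B by split=> //; exists (- r) => x /Br; rewrite ler_norml => /andP[].
apply/lee_addgt0Pr => e e0.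
have e2 : 0 < e / 2 by rewrite divr_gt0.
(* Scaled copies of [A] and [B] in [C], attached to almost extremal points, which
   overlap in a short interval only. *)
have [a Aa aA] := sup_adherent (divr_gt0 e2 m_gt0) supA.
have [b Bb bB] := inf_adherent e2 infB.
pose M : R := m.+1%:R.
(* As sets, [D1 = (m A + b) / M] and [D2 = (m a + B) / M]. *)
pose D1 := [set c : RB | A (M / m%:R * c + - (b / m%:R))].
pose D2 := [set c : RB | B (M * c + - (m%:R * a))].
have D1C : D1 `<=` C.
  move=> c /ABC /(_ Bb); congr C; rewrite -/M; field.
  by rewrite nat1r m1_neq0.
have D2C : D2 `<=` C.
  move=> c /(ABC _ _ Aa); congr C; rewrite -/M; field.
  by rewrite nat1r.
have mD1 : measurable D1.
  by rewrite -[X in measurable X]setTI; exact: (measurable_affine _ _ measurableT mA).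
have mD2 : measurable D2.
  by rewrite -[X in measurable X]setTI; exact: (measurable_affine _ _ measurableT mB).
have lD1 : (m%:R%:E * leb A = M%:E * leb D1)%E.
  rewrite lebesgue_affine ?mulf_neq0 ?invr_neq0// muleA -EFinM; congr (_%:E * _)%E.
  by rewrite gtr0_norm ?divr_gt0//; field; rewrite nat1r m1_neq0 andbT.
have lD2 : (leb B = M%:E * leb D2)%E.
  by rewrite lebesgue_affine// muleA -EFinM gtr0_norm// mulfV// mul1e.
(* [D1] lies below [u], [D2] above [l], and [M (u - l) = m (sup A - a) + (b - inf B) <= e]. *)
pose l := (m%:R * a + inf B) / M; pose u := (m%:R * sup A + b) / M.
have D12 : D1 `&` D2 `<=` `[l, u]%classic.
  move=> c [/(ub_le_sup supA.2) cA /(ge_inf infB.2) cB] /=.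
  rewrite in_itv /= /l /u ler_pdivrMr// ler_pdivlMr//; apply/andP; split.
    by move: cB; rewrite lerBrDr (mulrC M) addrC.
  rewrite -lerBlDr -ler_pdivrMl//; apply: le_trans cA.
  by rewrite le_eqVlt; apply/orP; left; apply/eqP; field.
have lu : (leb (D1 `&` D2) <= (e / M)%:E)%E.
  apply: le_trans (lebesgue_monotone D12) _.
  rewrite lebesgue_measure_itv /= lte_fin; case: ifP => _; last first.
    by rewrite lee_fin divr_ge0// ltW.
  rewrite -EFinB lee_fin /l /u -mulrBl ler_pM2r ?invr_gt0//.
  have : m%:R * (sup A - a) <= e / 2.
    by rewrite -ler_pdivlMl// mulrC lerBlDr -lerBlDl ltW.
  by move: bB; rewrite -ltrBlDl; lra.
rewrite lD1 lD2 -muleDr ?ge0_adde_def ?inE//.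
have -> : e%:E = (M%:E * (e / M)%:E)%E :> \bar R.
  by rewrite -EFinM mulrC mulfVK.
rewrite -muleDr ?ge0_adde_def ?inE// ?lee_fin ?divr_ge0// ?(ltW e0)//.
apply: lee_wpmul2l; first by rewrite lee_fin.
rewrite (measureDI leb mD1 mD2) -addeA (addeC (leb (D1 `&` D2))) addeA.
apply: leeD lu; rewrite -measureU//; last 2 first.
- exact: measurableD.
- by apply/seteqP; split => // c [[_ nD2] /nD2].
by apply: lebesgue_monotone => c [[/D1C//]|/D2C//].
Qed.

(** As [f] and [g] both have supremum 1, their superlevel sets are nonempty for the same [t] in [[0,
    1[]. There [brunn_minkowski1] applies, and integrating over [t] gives an additive inequality. *)
Lemma prekopa_leindler1_normalized (m : nat) (f g h : RB -> R) (r : R) :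
  (0 < m)%N -> measurable_fun setT f -> measurable_fun setT g ->
  measurable_fun setT h ->
  (forall x, 0 <= f x <= 1) -> (forall x, 0 <= g x <= 1) -> (forall x, 0 <= h x) ->
  (forall t, t < 1 -> exists x, t < f x) ->
  (forall t, t < 1 -> exists x, t < g x) ->
  (forall x, 0 < f x -> `|x| <= r) -> (forall x, 0 < g x -> `|x| <= r) ->
  (forall x y, f x ^+ m * g y <= h ((m%:R * x + y) / m.+1%:R) ^+ m.+1) ->
  (m%:R%:E * \int[leb]_x (f x)%:E + \int[leb]_x (g x)%:E <=
   m.+1%:R%:E * \int[leb]_x (h x)%:E)%E.
Proof.
move=> m0 mf mg mh f01 g01 h0 fsup gsup fr gr fgh.
have f0 x : 0 <= f x by case/andP: (f01 x).
have g0 x : 0 <= g x by case/andP: (g01 x).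
have lev0 k t : (0 <= level k t)%E by rewrite /level; case: ifP.
rewrite !layer_cake// -!ge0_integralZl//; try exact: measurable_level.
rewrite -ge0_integralD//; first last.
- exact: measurable_level.
- by apply: measurable_funeM; exact: measurable_level.
- by move=> t _; rewrite mule_ge0.
apply: ge0_integral_monotone => t; first by rewrite adde_ge0// mule_ge0.
rewrite /level; case: ifP => [t0|_]; last by rewrite !mule0 adde0.
have [t1|t1] := ltP t 1; last first.
  have E0 (k : RB -> R) : (forall x, 0 <= k x <= 1) -> [set x | t < k x] = set0.
    move=> k01; apply/seteqP; split => // x /=; apply/negP; rewrite -leNgt.
    by case/andP: (k01 x) => _ /le_trans; apply.
  by rewrite (E0 _ f01) (E0 _ g01) measure0 mule0 adde0 mule_ge0.
apply: (@brunn_minkowski1 _ _ _ _ r) => //; try exact: measurable_superlevel.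
- exact: fsup.
- exact: gsup.
- by move=> x /= /(le_lt_trans t0)/fr.
- by move=> x /= /(le_lt_trans t0)/gr.
move=> x y /= tf tg; rewrite -(ltr_pXn2r (ltn0Sn m)) ?nnegrE//.
apply: lt_le_trans (fgh x y); rewrite exprSr.
apply: ltr_pM => //; first by rewrite exprn_ge0.
by rewrite ltr_pXn2r// nnegrE.
Qed.

End PrekopaLeindler1.

Section PrekopaLeindler.
Context {R : realType}.
Notation leb := (@lebesgue_measure R).
Notation RB := (measurableTypeR R).

Lemma integral_bounded_support d (T : measurableType d)
    (mu : {measure set T -> \bar R}) (f : T -> R) (C : R) (K : set T) :
  measurable K -> measurable_fun setT f -> (forall x, 0 <= f x <= C) ->
  (forall x, 0 < f x -> K x) ->
  (\int[mu]_x (f x)%:E <= C%:E * mu K)%E.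
Proof.
move=> mK mf fC fK; rewrite -[K in leRHS]setIT -(integral_indic mu measurableT mK).
(* When [T] is empty [C] may be negative; otherwise a point of [T] shows [0 <= C]. *)
have [x0|/forallNP noT] := pselect (exists x : T, True); last first.
  rewrite integral0_eq; last by move=> x _; case: (noT x).
  by rewrite integral0_eq ?mule0// => x _; case: (noT x).
have C0 : 0 <= C by case: x0 => x _; case/andP: (fC x) => /le_trans h /h.
rewrite -ge0_integralZl//; last first.
  by apply/measurable_EFinP; exact: measurable_indic.
apply: ge0_integral_monotone => x; first by rewrite lee_fin; case/andP: (fC x).
rewrite -EFinM lee_fin indicE; case/andP: (fC x) => f0 fxC.
have [/mem_set -> |nKx] := pselect (K x); first by rewrite mulr1.
rewrite memNset// mulr0 leNgt; apply/negP => /fK; exact: nKx.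
Qed.

(** Dividing [f], [g] and [h] by [sup f], [sup g] and the weighted geometric mean [th] of the two
    suprema gives the normalized case; [weighted_AGM] turns its additive conclusion into a
    product. *)
Lemma prekopa_leindler1 (m : nat) (f g h : RB -> R) (r C : R) :
  (0 < m)%N -> measurable_fun setT f -> measurable_fun setT g ->
  measurable_fun setT h ->
  (forall x, 0 <= f x <= C) -> (forall x, 0 <= g x <= C) -> (forall x, 0 <= h x <= C) ->
  (forall x, 0 < f x -> `|x| <= r) -> (forall x, 0 < g x -> `|x| <= r) ->
  (forall x, 0 < h x -> `|x| <= r) ->
  (forall x y, f x ^+ m * g y <= h ((m%:R * x + y) / m.+1%:R) ^+ m.+1) ->
  fine (\int[leb]_x (f x)%:E) ^+ m * fine (\int[leb]_x (g x)%:E) <=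
  fine (\int[leb]_x (h x)%:E) ^+ m.+1.
Proof.
move=> m0 mf mg mh fC gC hC fr gr hr fgh.
have int0 (k : RB -> R) : (forall x, 0 <= k x <= C) ->
    (0 <= \int[leb]_x (k x)%:E)%E.
  by move=> kC; apply: integral_ge0 => x _; rewrite lee_fin; case/andP: (kC x).
have intf (k : RB -> R) : measurable_fun setT k -> (forall x, 0 <= k x <= C) ->
    (forall x, 0 < k x -> `|x| <= r) -> (\int[leb]_x (k x)%:E)%E \is a fin_num.
  move=> mk kC kr; rewrite ge0_fin_numE ?int0//.
  have kr' x : 0 < k x -> `[-r, r]%classic x by move=> /kr; rewrite /= in_itv /= ler_norml.
  apply: (le_lt_trans (integral_bounded_support leb (measurable_itv `[- r, r]) mk kC kr')).
  rewrite /= lebesgue_measure_itv /=; case: ifP => _; last by rewrite mule0 ltry.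
  by rewrite -EFinB -EFinM ltry.
have hs (k : RB -> R) : (forall x, 0 <= k x <= C) -> has_sup (range k).
  move=> kC; split; first by exists (k 0), 0.
  by exists C => _ [x _ <-]; case/andP: (kC x).
have le_sup (k : RB -> R) (kC : forall x, 0 <= k x <= C) x : k x <= sup (range k).
  by apply: sup_upper_bound; [exact: hs|exists x].
have sup0 (k : RB -> R) (kC : forall x, 0 <= k x <= C) : 0 <= sup (range k).
  by apply: le_trans (le_sup k kC 0); case/andP: (kC 0).
have sup_eq0 (k : RB -> R) : (forall x, 0 <= k x <= C) -> sup (range k) = 0 ->
    (\int[leb]_x (k x)%:E)%E = 0%E.
  move=> kC k0; apply: integral0_eq => x _; congr (_%:E); apply/eqP.
  by rewrite eq_le -[X in _ <= X]k0 le_sup//; case/andP: (kC x).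
have Ih0 := int0 h hC.
(* If a supremum vanishes, so does the integral, and the left side is 0; for [f] this uses
   [m > 0]. *)
have [fs0|fs0] := eqVneq (sup (range f)) 0.
  by rewrite (sup_eq0 f)//= expr0n gtn_eqF// mul0r exprn_ge0// fine_ge0.
have [gs0|gs0] := eqVneq (sup (range g)) 0.
  by rewrite (sup_eq0 g)//= mulr0 exprn_ge0// fine_ge0.
set a := sup (range f) in fs0; set b := sup (range g) in gs0.
have a0 : 0 < a by rewrite lt_neqAle eq_sym fs0 sup0.
have b0 : 0 < b by rewrite lt_neqAle eq_sym gs0 sup0.
pose th := (a ^+ m * b) `^ (m.+1%:R^-1).
have ab0 : 0 < a ^+ m * b by rewrite mulr_gt0// exprn_gt0.
have th0 : 0 < th by rewrite powR_gt0.
have thE : th ^+ m.+1 = a ^+ m * b.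
  by rewrite -powR_mulrn ?powR_ge0// -powRrM mulVf ?pnatr_eq0// powRr1// ltW.
have scaled (k : RB -> R) (c : R) : measurable_fun setT k ->
    (forall x, 0 <= k x <= C) -> (forall x, 0 < k x -> `|x| <= r) -> 0 < c ->
    (\int[leb]_x (k x / c)%:E = (fine (\int[leb]_x (k x)%:E) / c)%:E)%E.
  move=> mk kC kr c0; under eq_integral do rewrite mulrC EFinM.
  rewrite ge0_integralZl//.
  - by rewrite mulrC EFinM fineK ?intf.
  - exact/measurable_EFinP.
  - by move=> x _; rewrite lee_fin; case/andP: (kC x).
  - by rewrite lee_fin invr_ge0 ltW.
have mdiv (k : RB -> R) (c : R) : measurable_fun setT k ->
    measurable_fun setT (fun x : RB => k x / c).
  by move=> mk; apply: measurable_funM => //; exact: measurable_cst.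
have sup1 (k : RB -> R) (kC : forall x, 0 <= k x <= C) : 0 < sup (range k) ->
    forall t, t < 1 -> exists x, t < k x / sup (range k).
  move=> s0 t t1; have : t * sup (range k) < sup (range k) by rewrite gtr_pMl.
  move=> /sup_gt[|_ [x _ <-] tk]; first by case: (hs k kC).
  by exists x; rewrite ltr_pdivlMr.
have ratio (k : RB -> R) (kC : forall x, 0 <= k x <= C) x :
    0 < sup (range k) -> 0 <= k x / sup (range k) <= 1.
  by move=> s0; rewrite divr_ge0 ?ler_pdivrMr ?mul1r ?le_sup// ?sup0//; case/andP: (kC x).
have := @prekopa_leindler1_normalized R m (fun x => f x / a) (fun x => g x / b)
  (fun x => h x / th) r m0 (mdiv f a mf) (mdiv g b mg) (mdiv h th mh).
rewrite !scaled//.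
have posdiv (k : RB -> R) c x : 0 < c -> 0 < k x / c -> 0 < k x.
  by move=> c0; rewrite pmulr_lgt0// invr_gt0.
move=> /(_ (fun x => ratio f fC x a0) (fun x => ratio g gC x b0)).
move=> /(_ _ (sup1 f fC a0) (sup1 g gC b0)).
move=> /(_ _ (fun x h => fr x (posdiv _ _ _ a0 h)) (fun x h => gr x (posdiv _ _ _ b0 h))).
set If := fine _; set Ig := fine _; set Ih := fine _.
have If0 : 0 <= If by rewrite fine_ge0// int0.
have Ig0 : 0 <= Ig by rewrite fine_ge0// int0.
have Ihh0 : 0 <= Ih by rewrite fine_ge0.
rewrite -!EFinM -EFinD lee_fin => main.
have {}main : m%:R * (If / a) + Ig / b <= m.+1%:R * (Ih / th).
  apply: main => [x|x y].
    by rewrite divr_ge0 ?(ltW th0)//; case/andP: (hC x).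
  rewrite !expr_div_n thE mulrACA -invfM ler_pM2r ?invr_gt0//.
have AG := weighted_AGM m (divr_ge0 If0 (ltW a0)) (divr_ge0 Ig0 (ltW b0)).
have le2 : ((m%:R * (If / a) + Ig / b) / m.+1%:R) ^+ m.+1 <= (Ih / th) ^+ m.+1.
  apply: lerXn2r; rewrite ?nnegrE.
  - rewrite divr_ge0// addr_ge0//; [apply: mulr_ge0 => //|]; apply: divr_ge0 => //; exact: ltW.
  - by rewrite divr_ge0// ltW.
  - by rewrite ler_pdivrMr ?ltr0n// [leRHS]mulrC.
by have := le_trans AG le2; rewrite !expr_div_n thE mulrACA -invfM ler_pM2r ?invr_gt0.
Qed.

Definition rmix n (m : nat) (x y : Rn R n) : Rn R n :=
  [tuple (m%:R * tnth x i + tnth y i) / m.+1%:R | i < n].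

Lemma rmix_tcons n m (u v : Rn R n) (x y : R) :
  rmix m (tcons (u, x)) (tcons (v, y)) =
  tcons (rmix m u v, (m%:R * x + y) / m.+1%:R).
Proof.
apply: eq_from_tnth => i; rewrite tnth_mktuple.
by case: (unliftP ord0 i) => [j ->|->]; rewrite ?tnthS ?tnth_mktuple ?tnth0.
Qed.

(** For bounded [f] of bounded support the integral is finite ([slice_intK]), and [slice_int f] is
    again bounded with bounded support, as the induction on the dimension requires. *)
Definition slice_int n (f : Rn R n.+1 -> R) (u : Rn R n) : R :=
  fine (\int[leb]_x (f (tcons (u, x)))%:E).

Section Slices.
Variables (n : nat) (f : Rn R n.+1 -> R) (r C : R).
Hypotheses (mf : measurable_fun setT f) (fC : forall t, 0 <= f t <= C)
  (fr : forall t, 0 < f t -> forall i, `|tnth t i| <= r).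

Let f0 t : 0 <= f t. Proof. by case/andP: (fC t). Qed.

Lemma measurable_slice u : measurable_fun setT (fun x : RB => f (tcons (u, x))).
Proof.
apply: measurableT_comp mf _; apply: measurableT_comp (measurable_tcons (n := n)) _.
exact: measurable_pair1.
Qed.

Lemma slice_support u (x : RB) : 0 < f (tcons (u, x)) ->
  `|x| <= r /\ forall i, `|tnth u i| <= r.
Proof.
move=> /fr h; split; first by have := h ord0; rewrite tnth0.
by move=> i; have := h (lift ord0 i); rewrite tnthS.
Qed.

Lemma slice_int_bound u :
  (0 <= \int[leb]_x (f (tcons (u, x)))%:E <= (C * fine (leb `[- r, r]%classic))%:E)%E.
Proof.
rewrite integral_ge0/=; last by move=> x _; rewrite lee_fin.
have sr x : 0 < f (tcons (u, x)) -> `[- r, r]%classic x.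
  by move=> /slice_support[]; rewrite /= in_itv /= ler_norml.
apply: (le_trans (integral_bounded_support leb (measurable_itv `[- r, r])
  (measurable_slice u) (fun x => fC _) sr)).
rewrite EFinM fineK// /= lebesgue_measure_itv /=; case: ifP => // _.
Qed.

Lemma slice_intK u :
  (slice_int f u)%:E = (\int[leb]_x (f (tcons (u, x)))%:E)%E.
Proof.
rewrite /slice_int fineK// ge0_fin_numE; last by case/andP: (slice_int_bound u).
by case/andP: (slice_int_bound u) => _ /le_lt_trans; apply; rewrite ltry.
Qed.

Lemma slice_int_itv u : 0 <= slice_int f u <= C * fine (leb `[- r, r]%classic).
Proof. by rewrite -!lee_fin slice_intK slice_int_bound. Qed.

Lemma slice_int_support u : 0 < slice_int f u -> forall i, `|tnth u i| <= r.
Proof.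
move=> Fu; have [[x fx]|/forallNP nox] := pselect (exists x, 0 < f (tcons (u, x))).
  by case: (slice_support fx).
move: Fu; rewrite /slice_int integral0_eq ?ltxx// => x _; congr (_%:E).
by apply/eqP; rewrite eq_le f0 andbT leNgt; apply/negP/nox.
Qed.

Lemma measurable_slice_int : measurable_fun setT (slice_int f).
Proof.
apply: (measurableT_comp (fine_measurable measurableT)).
apply: (measurable_fun_fubini_tonelli_F (m2 := leb)
  (fun z => (f (tcons z))%:E)) => [|z]; last by rewrite lee_fin.
by apply/measurable_EFinP; exact: measurableT_comp mf (measurable_tcons (n := n)).
Qed.

Lemma integral_slice_int :
  (\int[lebesgueRn n.+1]_t (f t)%:E = \int[lebesgueRn n]_u (slice_int f u)%:E)%E.
Proof.
rewrite integral_lebesgueRnS; last 2 first.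
- exact/measurable_EFinP.
- by move=> t; rewrite lee_fin.
by apply: eq_integral => u _; rewrite slice_intK.
Qed.

End Slices.

(** By [prekopa_leindler1], the slice integrals of [f], [g] and [h] satisfy the hypothesis one
    dimension lower. In dimension 0 hypothesis and conclusion agree. *)
Theorem prekopa_leindler n (m : nat) (f g h : Rn R n -> R) (r C : R) :
  (0 < m)%N -> measurable_fun setT f -> measurable_fun setT g ->
  measurable_fun setT h ->
  (forall x, 0 <= f x <= C) -> (forall x, 0 <= g x <= C) -> (forall x, 0 <= h x <= C) ->
  (forall x, 0 < f x -> forall i, `|tnth x i| <= r) ->
  (forall x, 0 < g x -> forall i, `|tnth x i| <= r) ->
  (forall x, 0 < h x -> forall i, `|tnth x i| <= r) ->
  (forall x y, f x ^+ m * g y <= h (rmix m x y) ^+ m.+1) ->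
  fine (\int[lebesgueRn n]_x (f x)%:E) ^+ m * fine (\int[lebesgueRn n]_x (g x)%:E) <=
  fine (\int[lebesgueRn n]_x (h x)%:E) ^+ m.+1.
Proof.
move=> m0; elim: n f g h C => [|n IH] f g h C mf mg mh fC gC hC fr gr hr fgh.
  have int0 k : measurable_fun setT k ->
      fine (\int[lebesgueRn 0]_x (k x)%:E)%E = k [tuple].
    move=> mk; rewrite [X in fine X](integral_dirac _ measurableT) ?diracT ?mul1e//.
    exact/measurable_EFinP.
  rewrite !int0//; apply: le_trans (fgh _ _) _.
  by rewrite (tuple0 (rmix _ _ _)).
rewrite (integral_slice_int mf fC fr) (integral_slice_int mg gC gr).
rewrite (integral_slice_int mh hC hr).
apply: (IH _ _ _ (C * fine (leb `[- r, r]%classic))).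
- exact: measurable_slice_int mf fC.
- exact: measurable_slice_int mg gC.
- exact: measurable_slice_int mh hC.
- exact: slice_int_itv mf fC fr.
- exact: slice_int_itv mg gC gr.
- exact: slice_int_itv mh hC hr.
- exact: slice_int_support fC fr.
- exact: slice_int_support gC gr.
- exact: slice_int_support hC hr.
move=> u v; apply: (@prekopa_leindler1 m _ _ _ r C m0).
- exact: measurable_slice.
- exact: measurable_slice.
- exact: measurable_slice.
- by move=> x; exact: fC.
- by move=> x; exact: gC.
- by move=> x; exact: hC.
- by move=> x /(slice_support fr)[].
- by move=> x /(slice_support gr)[].
- by move=> x /(slice_support hr)[].
by move=> x y; rewrite -rmix_tcons; exact: fgh.
Qed.

(** [prekopa_leindler] for indicator functions. *)
Lemma lebesgueRn_log_concave n (m : nat) (A B C : set (Rn R n)) (r : R) :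
  (0 < m)%N -> measurable A -> measurable B -> measurable C ->
  (forall x, (A `|` B `|` C) x -> forall i, `|tnth x i| <= r) ->
  (forall x y, A x -> B y -> C (rmix m x y)) ->
  fine (lebesgueRn n A) ^+ m * fine (lebesgueRn n B) <=
  fine (lebesgueRn n C) ^+ m.+1.
Proof.
move=> m0 mA mB mC ABCr ABC.
have E (X : set (Rn R n)) : measurable X ->
    lebesgueRn n X = (\int[lebesgueRn n]_x (\1_X x)%:E)%E.
  by move=> mX; rewrite integral_indic// setIT.
have ind01 (X : set (Rn R n)) x : 0 <= (\1_X x : R) <= 1.
  by rewrite indicE; case: (_ \in _); rewrite ?lexx ?ler01.
have indP (X : set (Rn R n)) x : 0 < (\1_X x : R) -> X x.
  by rewrite indicE ltr0n lt0b => /set_mem.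
rewrite !E//; apply: (@prekopa_leindler n m _ _ _ r 1 m0) => //.
- by move=> x /indP Ax; apply: ABCr; left; left.
- by move=> x /indP Ax; apply: ABCr; left; right.
- by move=> x /indP Ax; apply: ABCr; right.
move=> x y; rewrite !indicE.
have [/set_mem Ax|_] := boolP (x \in A); last by rewrite expr0n gtn_eqF// mul0r exprn_ge0.
have [/set_mem By|_] := boolP (y \in B); last by rewrite mulr0 exprn_ge0.
by rewrite (mem_set (ABC _ _ Ax By)) !expr1n mulr1.
Qed.

End PrekopaLeindler.

(** * Symmetric parts at averages of points *)

Section Averages.
Context {R : realType} {n : nat}.
Variables (K : set (Rn R n)) (r : R).
Hypotheses (mK : measurable K) (Kr : forall x, K x -> forall i, `|tnth x i| <= r)
  (Kmix : forall m x y, (0 < m)%N -> K x -> K y -> K (rmix m x y)).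

Definition ravg (s : seq (Rn R n)) : Rn R n :=
  [tuple (\sum_(z <- s) tnth z i) / (size s)%:R | i < n].

(** [w] is half the difference of [z + w] and [z - w]. *)
Lemma sym_part_bounded z w : sym_part K z w -> forall i, `|tnth w i| <= r.
Proof.
move=> [/Kr h1 /Kr h2] i; move: (h1 i) (h2 i).
rewrite tnth_radd tnth_rsub !ler_norml => /andP[? ?] /andP[? ?].
by apply/andP; split; lra.
Qed.

(** [rmix m] sends the symmetric parts at [z1] and [z2] into the one at [rmix m z1 z2], so that
    log-concavity applies. *)
Lemma sym_part_mix (m : nat) (c : R) z1 z2 : (0 < m)%N -> 0 <= c ->
  c <= fine (lebesgueRn n (sym_part K z1)) ->
  c <= fine (lebesgueRn n (sym_part K z2)) ->
  c <= fine (lebesgueRn n (sym_part K (rmix m z1 z2))).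
Proof.
move=> m0 c0 c1 c2; rewrite -(@ler_pXn2r _ m.+1)// ?nnegrE ?fine_ge0//.
rewrite exprSr.
apply: (@le_trans _ _ (fine (lebesgueRn n (sym_part K z1)) ^+ m *
                       fine (lebesgueRn n (sym_part K z2)))).
  by apply: ler_pM => //; [exact: exprn_ge0|apply: lerXn2r; rewrite ?nnegrE ?fine_ge0].
apply: (@lebesgueRn_log_concave _ _ _ _ _ _ r m0); try exact: measurable_sym_part.
  by move=> x [[|]|] /sym_part_bounded.
move=> x y [x1 x2] [y1 y2]; split.
  rewrite (_ : radd _ _ = rmix m (radd z1 x) (radd z2 y)); first exact: Kmix.
  by apply: eq_from_tnth => i; rewrite !(tnth_mktuple, tnth_radd); ring.
rewrite (_ : rsub _ _ = rmix m (rsub z1 x) (rsub z2 y)); first exact: Kmix.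
by apply: eq_from_tnth => i; rewrite !(tnth_mktuple, tnth_rsub); ring.
Qed.

Lemma sym_part_avg (c : R) (s : seq (Rn R n)) : 0 <= c -> (0 < size s)%N ->
  (forall z, z \in s -> c <= fine (lebesgueRn n (sym_part K z))) ->
  c <= fine (lebesgueRn n (sym_part K (ravg s))).
Proof.
move=> c0; case: s => // z s _; elim: s z => [|z' s IH] z sc.
  rewrite (_ : ravg _ = z); first by rewrite sc// inE.
  by apply: eq_from_tnth => i; rewrite tnth_mktuple big_seq1 divr1.
(* The average of [z :: z' :: s] mixes [z] with the average of the tail, weighted by the size of the
   tail. *)
rewrite (_ : ravg _ = rmix (size (z' :: s)) (ravg (z' :: s)) z).
  apply: sym_part_mix => //; last by rewrite sc// inE eqxx.
  by apply: IH => y ys; apply: sc; rewrite inE ys orbT.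
apply: eq_from_tnth => i; rewrite !tnth_mktuple big_cons; congr (_ / _).
by rewrite mulrC divfK ?pnatr_eq0// addrC.
Qed.

End Averages.

(** * Copositive matrices *)

Section QuadraticForms.
Context {R : realType} {n : nat}.
Implicit Types (A B : 'M[R]_n) (x y : 'I_n -> R).

Definition qf A y : R := \sum_i \sum_j A i j * (y i * y j).

Definition cop A : Prop := forall y, (forall i, 0 <= y i) -> 0 <= qf A y.

Definition psd A : Prop := forall y, 0 <= qf A y.

Definition ones : 'M[R]_n := const_mx 1.

Lemma qfD A B y : qf (A + B) y = qf A y + qf B y.
Proof.
rewrite -big_split; apply: eq_bigr => i _ /=; rewrite -big_split.
by apply: eq_bigr => j _; rewrite mxE mulrDl.
Qed.

Lemma qfZ (c : R) A y : qf (c *: A) y = c * qf A y.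
Proof.
rewrite /qf mulr_sumr; apply: eq_bigr => i _; rewrite mulr_sumr.
by apply: eq_bigr => j _; rewrite mxE -mulrA.
Qed.

Lemma qfN A y : qf (- A) y = - qf A y.
Proof. by rewrite -scaleN1r qfZ mulN1r. Qed.

Lemma qf_ones y : qf ones y = (\sum_i y i) ^+ 2.
Proof.
rewrite expr2 mulr_suml; apply: eq_bigr => i _; rewrite mulr_sumr.
by apply: eq_bigr => j _; rewrite mxE mul1r.
Qed.

Lemma qf_scalar (c : R) y : qf c%:M y = c * \sum_i y i ^+ 2.
Proof.
rewrite mulr_sumr; apply: eq_bigr => i _.
rewrite (bigD1 i)//= big1 ?addr0; first by rewrite mxE eqxx mulr1n -expr2.
by move=> j ji; rewrite mxE eq_sym (negPf ji) mulr0n mul0r.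
Qed.

Lemma qf_parallelogram A x y :
  qf A (fun i => x i - y i) + qf A (fun i => x i + y i) = 2 * qf A x + 2 * qf A y.
Proof.
rewrite /qf !mulr_sumr -!big_split; apply: eq_bigr => i _ /=.
rewrite !mulr_sumr -!big_split; apply: eq_bigr => j _ /=; ring.
Qed.

Definition delta (i : 'I_n) : 'I_n -> R := fun k => (k == i)%:R.

Lemma sum_delta (F : 'I_n -> R) i : \sum_k F k * delta i k = F i.
Proof.
rewrite (bigD1 i)//= big1 ?addr0 /delta ?eqxx ?mulr1// => k /negPf ->.
by rewrite mulr0.
Qed.

Lemma qf_delta A i : qf A (delta i) = A i i.
Proof.
rewrite -(sum_delta (fun k => A k i)); apply: eq_bigr => k _.
by rewrite -(sum_delta (A k)) mulr_suml; apply: eq_bigr => j _; ring.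
Qed.

Lemma qf_delta2 A i j :
  qf A (fun k => delta i k + delta j k) = A i i + A j j + A i j + A j i.
Proof.
transitivity (\sum_k (A k i + A k j) * (delta i k + delta j k)).
  apply: eq_bigr => k _.
  rewrite -{1}(sum_delta (A k) i) -(sum_delta (A k) j) -big_split mulr_suml.
  by apply: eq_bigr => l _ /=; ring.
under eq_bigr do rewrite mulrDr.
rewrite big_split /= (sum_delta (fun k => A k i + A k j)).
rewrite (sum_delta (fun k => A k i + A k j)); ring.
Qed.

(* Up to the factor [n * (n + 2)], the integral over the sphere of the even
   quartic with matrix [A]. *)
Definition lform A : R := 2 * \tr A + qf A (fun=> 1).

Lemma lformD A B : lform (A + B) = lform A + lform B.
Proof. by rewrite /lform mxtraceD qfD; ring. Qed.

Lemma lformZ (c : R) A : lform (c *: A) = c * lform A.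
Proof. by rewrite /lform mxtraceZ qfZ; ring. Qed.

Lemma lform_ones : lform ones = n%:R * (n%:R + 2).
Proof.
rewrite /lform qf_ones /mxtrace.
under eq_bigr do rewrite mxE.
by rewrite !sumr_const card_ord; ring.
Qed.

Lemma lform_scalar (c : R) : lform c%:M = 3 * n%:R * c.
Proof.
rewrite /lform qf_scalar mxtrace_scalar.
under eq_bigr do rewrite expr1n.
by rewrite sumr_const card_ord -mulr_natr; ring.
Qed.

Lemma cop_diag A i : cop A -> 0 <= A i i.
Proof. by move=> /(_ (delta i)); rewrite qf_delta; apply => k; rewrite ler0n. Qed.

Lemma cop_sum A : cop A -> 0 <= qf A (fun=> 1).
Proof. by apply => i; rewrite ler01. Qed.

Lemma cop_trace A : cop A -> \tr A <= lform A / 2.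
Proof. by move=> /cop_sum; rewrite /lform; lra. Qed.

Lemma cop_diag_le A i : cop A -> A i i <= lform A / 2.
Proof.
move=> cA; apply: le_trans (cop_trace cA); rewrite /mxtrace (bigD1 i)//= lerDl.
by apply: sumr_ge0 => j _; exact: cop_diag.
Qed.

(** Copositivity at [e_i + e_j] bounds [A i j] from below in terms of the diagonal. *)
Lemma cop_entry_ge A i j : A^T = A -> cop A -> - (lform A / 2) <= A i j.
Proof.
move=> sA cA; have := cop_diag_le i cA; have := cop_diag_le j cA.
have := cop_diag i cA; have := cop_diag j cA.
have := cA (fun k => delta i k + delta j k); rewrite qf_delta2.
have -> : A j i = A i j by rewrite -[in LHS]sA mxE.
move=> /(_ (fun k => addr_ge0 (ler0n _ _) (ler0n _ _))); lra.
Qed.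

(** Shifted by [L / 2] all entries are nonnegative, so each is at most their sum; [lform A] controls
    the sum because the trace is nonnegative. *)
Lemma cop_entry_le A i j : A^T = A -> cop A ->
  A i j <= lform A * (1 + n%:R ^+ 2).
Proof.
move=> sA cA; set L := lform A.
have L0 : 0 <= L.
  have := cop_diag i cA; have := cop_diag_le i cA; rewrite -/L; lra.
have sumA : \sum_(p : 'I_n * 'I_n) (A p.1 p.2 + L / 2) <= L + n%:R ^+ 2 * L.
  rewrite big_split /= sumr_const card_prod card_ord.
  rewrite -(pair_bigA _ (fun i j => A i j)) /=.
  have -> : \sum_i \sum_j A i j = qf A (fun=> 1).
    by apply: eq_bigr => k _; apply: eq_bigr => l _; rewrite !mulr1.
  have tr0 : 0 <= \tr A by apply: sumr_ge0 => k _; exact: cop_diag.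
  have LE : L = 2 * \tr A + qf A (fun=> 1) by [].
  rewrite -[_ *+ (n * n)%N]mulr_natr natrM -expr2.
  have := mulr_ge0 (sqr_ge0 (n%:R : R)) L0; nra.
have : A i j + L / 2 <= L + n%:R ^+ 2 * L.
  apply: le_trans sumA; rewrite (bigD1 (i, j))//= lerDl; apply: sumr_ge0 => p _.
  by have := cop_entry_ge p.1 p.2 sA cA; rewrite -/L; lra.
lra.
Qed.

Lemma sqr_sum_le (x : 'I_n -> R) : (\sum_i x i) ^+ 2 <= n%:R * \sum_i x i ^+ 2.
Proof.
have : 0 <= \sum_i \sum_j (x i - x j) ^+ 2.
  by apply: sumr_ge0 => i _; apply: sumr_ge0 => j _; exact: sqr_ge0.
have -> : \sum_i \sum_j (x i - x j) ^+ 2 =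
    2 * (n%:R * \sum_i x i ^+ 2) - 2 * (\sum_i x i) ^+ 2.
  transitivity (\sum_(i < n) \sum_(j < n) x i ^+ 2 + \sum_(i < n) \sum_j x j ^+ 2 -
                2 * \sum_i \sum_j x i * x j).
    rewrite -big_split mulr_sumr -sumrB; apply: eq_bigr => i _ /=.
    rewrite -big_split mulr_sumr /=.
    by rewrite -sumrB; apply: eq_bigr => j _ /=; ring.
  under eq_bigr do rewrite sumr_const card_ord -mulr_natl.
  under [X in _ - _ * X]eq_bigr do rewrite -mulr_sumr.
  by rewrite -mulr_sumr sumr_const card_ord -mulr_suml -[_ *+ n]mulr_natl; ring.
lra.
Qed.

Lemma sum_sqr_le (x : 'I_n -> R) : (forall i, 0 <= x i) ->
  \sum_i x i ^+ 2 <= (\sum_i x i) ^+ 2.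
Proof.
move=> x0; rewrite [leRHS]expr2 mulr_suml; apply: ler_sum => i _.
by rewrite expr2 ler_wpM2l// (bigD1 i)//= lerDl sumr_ge0.
Qed.

(** Here [A = (d - e) I + e ones]. With [q] the sum of the [x_i^2], the form is at most
    [(d - e + n e) q] if [e >= 0], where [d >= 0] bounds [e] from above, and at most [d q] if
    [e < 0], where the value at the all-ones vector bounds [e] from below. *)
Lemma cop_two_valued_le A (d e : R) (x : 'I_n -> R) : (2 <= n)%N -> cop A ->
  (forall i j, A i j = if i == j then d else e) ->
  lform A = n%:R * (n%:R + 2) -> (forall i, 0 <= x i) ->
  qf A x <= (n%:R + 2) * \sum_i x i ^+ 2.
Proof.
move=> n2 cA Ade LA x0.
have n0 : 0 < n%:R :> R by rewrite ltr0n (leq_trans _ n2).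
have AE : A = (d - e)%:M + e *: ones.
  apply/matrixP => i j; rewrite Ade !mxE.
  by case: eqP => _; rewrite ?mulr1n ?mulr0n; ring.
have d0 : 0 <= d.
  by have := cop_diag (Ordinal (leq_trans (leqnSn 1) n2)) cA; rewrite Ade eqxx.
have := cop_sum cA; move: LA.
rewrite {1 2}AE lformD lformZ lform_scalar lform_ones !qfD qfZ qf_scalar qf_ones.
under eq_bigr do rewrite expr1n.
rewrite !sumr_const card_ord AE qfD qfZ qf_scalar qf_ones => LA S0.
have {}LA : 3 * (d - e) + (n%:R + 2) * e = n%:R + 2.
  apply: (mulfI (lt0r_neq0 n0)); rewrite -[RHS]LA; ring.
have := sqr_sum_le x; have := sum_sqr_le x0.
set s := \sum_i x i; set q := \sum_i x i ^+ 2 => qs sq.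
have q0 : 0 <= q by apply: sumr_ge0 => i _; exact: sqr_ge0.
have [e0|e0] := leP 0 e.
  have : e * s ^+ 2 <= e * (n%:R * q) by rewrite ler_wpM2l.
  nra.
have : e * s ^+ 2 <= e * q by rewrite ler_wnM2l// ltW.
have : 0 <= (d - e) + n%:R * e.
  by rewrite -(pmulr_rge0 _ n0); move: S0; rewrite -[1 *+ n]/(n%:R : R); lra.
nra.
Qed.

(* With [y = yp - ym], the parallelogram law expresses [qf A y] by the values of
   [qf A] at the nonnegative vectors [yp], [ym] and [yp + ym]. *)
Lemma psd_of_abs_cop A (c : R) :
  (forall x, (forall i, 0 <= x i) -> `|qf A x| <= c * \sum_i x i ^+ 2) ->
  forall y, - (3 * c * \sum_i y i ^+ 2) <= qf A y.
Proof.
move=> Ac y; pose yp i := Num.max (y i) 0; pose ym i := Num.max (- y i) 0.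
have yE i : y i = yp i - ym i.
  by rewrite /yp /ym; case: (leP (y i) 0); case: (leP (- y i) 0); lra.
have yp0 i : 0 <= yp i by rewrite /yp le_max lexx orbT.
have ym0 i : 0 <= ym i by rewrite /ym le_max lexx orbT.
have ypm i : yp i * ym i = 0.
  by rewrite /yp /ym; case: (leP (y i) 0); case: (leP (- y i) 0); nra.
have := qf_parallelogram A yp ym.
have -> : qf A (fun i => yp i - ym i) = qf A y.
  by apply: eq_bigr => i _; apply: eq_bigr => j _; rewrite -!yE.
have := Ac (fun i => yp i + ym i) (fun i => addr_ge0 (yp0 i) (ym0 i)).
have := Ac yp yp0; have := Ac ym ym0; rewrite !ler_norml.
have -> : \sum_i y i ^+ 2 = \sum_i yp i ^+ 2 + \sum_i ym i ^+ 2.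
  rewrite -big_split; apply: eq_bigr => i _ /=; rewrite yE.
  by have := ypm i; nra.
have -> : \sum_i (yp i + ym i) ^+ 2 = \sum_i yp i ^+ 2 + \sum_i ym i ^+ 2.
  by rewrite -big_split; apply: eq_bigr => i _ /=; have := ypm i; nra.
(* The factor 3 is 2 from the terms at [yp] and [ym] plus 1 from the term at [yp + ym]; all norms
   add up since [yp] and [ym] have disjoint supports. *)
by move=> /andP[? ?] /andP[? ?] /andP[? ?]; lra.
Qed.

End QuadraticForms.

Section RationalTest.
Context {R : realType} {n : nat}.

(* Makes copositivity a Borel condition. *)
Lemma cop_rat (A : 'M[R]_n) :
  (forall q : {ffun 'I_n -> rat}, 0 <= qf A (fun i => `|ratr (q i)|)) -> cop A.
Proof.
move=> Aq y y0; rewrite leNgt; apply/negP => qf0.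
(* For [d <= 1], raising each coordinate of [y] by less than [d] changes [qf A y] by at most
   [d * M]. *)
pose M := \sum_i \sum_j `|A i j| * (y i + y j + 1).
have M0 : 0 <= M.
  by apply: sumr_ge0 => i _; apply: sumr_ge0 => j _; rewrite mulr_ge0// !addr_ge0.
pose d := Num.min 1 (- qf A y / (M + 1)).
have M1 : 0 < M + 1 by lra.
have d0 : 0 < d by rewrite lt_min ltr01 divr_gt0// oppr_gt0.
have d1 : d <= 1 by rewrite /d ge_min lexx.
have dM : d * M < - qf A y.
  have : d <= - qf A y / (M + 1) by rewrite /d ge_min lexx orbT.
  rewrite ler_pdivlMr//; nra.
have qex i : exists q : rat, y i < ratr q < y i + d.
  have : y i < y i + d by rewrite ltrDl.
  by move=> /rat_in_itvoo[q]; rewrite in_itv /=; exists q.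
pose q : {ffun 'I_n -> rat} := [ffun i => projT1 (cid (qex i))].
have qP i : y i < ratr (q i) < y i + d by rewrite ffunE; exact: projT2 (cid (qex i)).
have := Aq q; apply/negP; rewrite -ltNge.
apply: (@le_lt_trans _ _ (qf A y + d * M)); last by move: dM; lra.
rewrite /qf /M mulr_sumr -big_split; apply: ler_sum => i _ /=.
rewrite mulr_sumr -big_split; apply: ler_sum => j _ /=.
have /andP[qi1 qi2] := qP i; have /andP[qj1 qj2] := qP j.
have yi := y0 i; have yj := y0 j.
have nq k : `|ratr (q k)| = ratr (q k) :> R.
  by rewrite ger0_norm//; apply: le_trans (y0 k) (ltW _); case/andP: (qP k).
rewrite !nq.
rewrite -lerBlDl -mulrBr; apply: le_trans (ler_norm _) _.
rewrite normrM [leRHS]mulrCA; apply: ler_wpM2l => //; rewrite ger0_norm; nra.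
Qed.

End RationalTest.

(** * Volume of the copositive body *)

Section Core.
Context {R : realType} {N n : nat}.
(** Linear coordinates on the symmetric matrices with [lform] zero: [E] is the basis and [c] reads
    the coordinates off a matrix. This is all that the volume comparison has to know about the
    isometry [phi]. *)
Variables (At : Rn R N -> 'M[R]_n) (E c : 'I_N -> 'M[R]_n).
Hypothesis AtE : forall t, At t = \sum_k tnth t k *: E k.
Hypothesis Asym : forall t, (At t)^T = At t.
Hypothesis Al : forall t, lform (At t) = 0.
Hypothesis Asurj : forall A, A^T = A -> lform A = 0 -> exists t, At t = A.
Hypothesis Acoord : forall t k, tnth t k = \sum_i \sum_j At t i j * c k i j.
Hypotheses (n2 : (2 <= n)%N) (N0 : (0 < N)%N).

Lemma At_raff a b t : At (raff a b t) = a *: At t + At b.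
Proof.
rewrite !AtE scaler_sumr -big_split; apply: eq_bigr => k _ /=.
by rewrite tnth_raff scalerDl scalerA.
Qed.

Lemma At_inj t u : At t = At u -> t = u.
Proof. by move=> tu; apply: eq_from_tnth => k; rewrite !Acoord tu. Qed.

Lemma At_rmix m t u :
  At (rmix m t u) = m.+1%:R^-1 *: (m%:R *: At t + At u).
Proof.
rewrite !AtE scaler_sumr -big_split scaler_sumr; apply: eq_bigr => k _ /=.
by rewrite tnth_mktuple scalerA -scalerDl scalerA mulrC.
Qed.

Lemma At_ravg (s : seq (Rn R N)) :
  At (ravg s) = (size s)%:R^-1 *: \sum_(z <- s) At z.
Proof.
rewrite AtE (eq_bigr (fun z => \sum_k tnth z k *: E k)); last by move=> z _; rewrite AtE.
rewrite exchange_big /= scaler_sumr; apply: eq_bigr => k _.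
by rewrite tnth_mktuple -scaler_suml scalerA mulrC.
Qed.

(** The body [K] of the overview: [ones] is the matrix of [(x_1^2 + ... + x_n^2)^2]. *)
Definition copK : set (Rn R N) := [set t | cop (At t + ones)].

Lemma lform_K t : lform (At t + ones) = n%:R * (n%:R + 2).
Proof. by rewrite lformD Al lform_ones add0r. Qed.

Lemma sym_K t : (At t + ones)^T = At t + ones.
Proof. by rewrite linearD /= Asym trmx_const. Qed.

Lemma copK_mix m x y : (0 < m)%N -> copK x -> copK y -> copK (rmix m x y).
Proof.
move=> m0 Kx Ky z z0; rewrite At_rmix.
have -> : m.+1%:R^-1 *: (m%:R *: At x + At y) + ones =
    m.+1%:R^-1 *: (m%:R *: (At x + ones) + (At y + ones)) :> 'M[R]_n.
  apply/matrixP => i j; rewrite !mxE.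
  have : m.+1%:R != 0 :> R by rewrite pnatr_eq0.
  by rewrite -natr1 => m1; field; rewrite addrC.
rewrite qfZ qfD qfZ mulr_ge0 ?invr_ge0// addr_ge0 ?mulr_ge0//; [exact: Kx|exact: Ky].
Qed.

Lemma copK_mid z w : copK (radd z w) -> copK (rsub z w) -> copK z.
Proof.
move=> Kp Km; rewrite (_ : z = rmix 1 (radd z w) (rsub z w)); first exact: copK_mix.
by apply: eq_from_tnth => i; rewrite tnth_mktuple tnth_radd tnth_rsub; field.
Qed.

(** Copositivity and the fixed value of [lform] bound the entries of [At t + ones], and the
    coordinates are linear in the entries. *)
Lemma copK_bounded : exists r, forall t, copK t -> forall i, `|tnth t i| <= r.
Proof.
pose L : R := n%:R * (n%:R + 2); pose b := L * (1 + n%:R ^+ 2) + 1.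
pose r := \sum_k \sum_i \sum_j b * `|c k i j|; exists r => t Kt k.
have L0 : 0 <= L by rewrite mulr_ge0// addr_ge0.
have b0 : 0 <= b by rewrite addr_ge0// mulr_ge0// addr_ge0// exprn_ge0.
have Ab i j : `|At t i j| <= b.
  have := cop_entry_ge i j (sym_K t) Kt; have := cop_entry_le i j (sym_K t) Kt.
  rewrite lform_K !mxE -/L ler_norml /b => h1 h2.
  have := mulr_ge0 L0 (sqr_ge0 (n%:R : R)) => h3.
  by apply/andP; split; nra.
rewrite Acoord; apply: (@le_trans _ _ (\sum_i \sum_j b * `|c k i j|)).
  apply: le_trans (ler_norm_sum _ _ _) _; apply: ler_sum => i _.
  apply: le_trans (ler_norm_sum _ _ _) _; apply: ler_sum => j _.
  by rewrite normrM ler_wpM2r.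
rewrite /r (bigD1 k)//= lerDl; apply: sumr_ge0 => l _.
by apply: sumr_ge0 => i _; apply: sumr_ge0 => j _; rewrite mulr_ge0.
Qed.

(** Near 0 the entries of [At t + ones] are nonnegative, which makes the matrix copositive. *)
Lemma copK_inner : exists2 d : R, 0 < d &
  forall t, (forall i, `|tnth t i| <= d) -> copK t.
Proof.
pose M := \sum_k \sum_i \sum_j `|E k i j|.
have M0 : 0 <= M.
  by do 3![apply: sumr_ge0 => ? _]; exact: normr_ge0.
exists (M + 1)^-1 => [|t td y y0]; first by rewrite invr_gt0; lra.
apply: sumr_ge0 => i _; apply: sumr_ge0 => j _; rewrite mulr_ge0 ?mulr_ge0//.
rewrite !mxE AtE summxE.
have : `|\sum_k (tnth t k *: E k) i j| <= 1.
  apply: le_trans (ler_norm_sum _ _ _) _.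
  apply: (@le_trans _ _ ((M + 1)^-1 * M)); last first.
    by rewrite mulrC ler_pdivrMr ?mul1r; lra.
  rewrite mulr_sumr; apply: ler_sum => k _; rewrite mxE normrM.
  apply: ler_pM => //.
  rewrite (bigD1 i)//= (bigD1 j)//= -addrA lerDl addr_ge0//; apply: sumr_ge0 => // l _.
  by apply: sumr_ge0.
by rewrite ler_norml => /andP[? _]; lra.
Qed.

Lemma measurable_qf_At B y :
  measurable_fun setT (fun t : Rn R N => qf (At t + B) y).
Proof.
rewrite (_ : (fun _ => _) = fun t => \sum_k tnth t k * qf (E k) y + qf B y); last first.
  apply/funext => t; rewrite qfD AtE; congr (_ + _).
  elim/big_rec2: _ => [|k u v _ <-]; last by rewrite qfD qfZ.
  by rewrite -(scale0r (0 : 'M[R]_n)) qfZ mul0r.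
apply: (@measurable_funD _ (Rn R N) R setT); last exact: measurable_cst.
apply: measurable_sum => k.
apply: (@measurable_funM _ (Rn R N) R setT); last exact: measurable_cst.
exact: measurable_tnth.
Qed.

Lemma measurable_copK : measurable copK.
Proof.
(* [unpickle] enumerates the rational vectors; a number that codes none imposes no condition. *)
pose F (k : nat) : set (Rn R N) :=
  if unpickle k is Some q then
    [set t | 0 <= qf (At t + ones) (fun i => `|ratr ((q : {ffun 'I_n -> rat}) i)|)]
  else setT.
rewrite (_ : copK = \bigcap_(k in setT) F k); last first.
  apply/seteqP; split=> t /= Kt.
    by move=> k _; rewrite /F; case: unpickle => // q; apply: Kt => i.
  apply: cop_rat => q; have := Kt (pickle q) I.
  by rewrite /F pickleK.
apply: bigcapT_measurable => k; rewrite /F; case: unpickle => // q.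
have := @measurable_fun_ler _ (Rn R N) R setT (cst 0) _ (measurable_cst _)
  (measurable_qf_At ones (fun i => `|ratr (q i)|)).
by move=> /(_ measurableT [set true]); rewrite setTI; exact.
Qed.

Lemma lebesgue_copK : (0 < lebesgueRn N copK < +oo)%E.
Proof.
apply/andP; split.
  by have [d d0 dK] := copK_inner; exact: lebesgueRn_gt0 d0 dK.
by have [r Kr] := copK_bounded; exact: lebesgueRn_bounded Kr.
Qed.

(** * Permutations of the variables *)

Definition permx (s : {perm 'I_n}) (A : 'M[R]_n) : 'M[R]_n :=
  \matrix_(i, j) A (s i) (s j).

Lemma qf_permx s A y : qf (permx s A) y = qf A (fun i => y (s^-1 i)%g).
Proof.
rewrite /qf [RHS](reindex_inj (@perm_inj _ s)); apply: eq_bigr => i _.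
rewrite [RHS](reindex_inj (@perm_inj _ s)); apply: eq_bigr => j _ /=.
by rewrite mxE !permK.
Qed.

Lemma lform_permx s A : lform (permx s A) = lform A.
Proof.
rewrite /lform qf_permx; congr (_ * _ + _).
rewrite /mxtrace [RHS](reindex_inj (@perm_inj _ s)).
by apply: eq_bigr => i _; rewrite mxE.
Qed.

Lemma permxK s : cancel (permx s) (permx s^-1).
Proof. by move=> A; apply/matrixP => i j; rewrite !mxE !permKV. Qed.

(* The action of a permutation of the variables in the coordinates [At]. *)
Definition permT s (t : Rn R N) : Rn R N :=
  [tuple \sum_i \sum_j permx s (At t) i j * c k i j | k < N].

Lemma At_permT s t : At (permT s t) = permx s (At t).
Proof.
(* The permuted matrix has coordinates by [Asurj], and by [Acoord] they are those of [permT s t]. *)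
have [|u uE] := Asurj (A := permx s (At t)) _ (etrans (lform_permx s _) (Al t)).
  by apply/matrixP => i j; rewrite !mxE -[in LHS](Asym t) mxE.
rewrite -uE; congr At; apply: eq_from_tnth => k.
by rewrite tnth_mktuple Acoord uE.
Qed.

Lemma permTK s : cancel (permT s^-1) (permT s).
Proof.
move=> t; apply: At_inj; rewrite !At_permT.
by have := permxK s^-1 (At t); rewrite invgK.
Qed.

Lemma permT_raff s a b t : permT s (raff a b t) = raff a (permT s b) (permT s t).
Proof.
apply: At_inj; rewrite At_raff !At_permT At_raff.
by apply/matrixP => i j; rewrite !mxE.
Qed.

Lemma measurable_permT s : measurable_fun setT (permT s).
Proof.
apply/measurable_fun_tnthP => k.
rewrite (_ : _ \o _ = fun t : Rn R N =>
    \sum_l tnth t l * \sum_i \sum_j E l (s i) (s j) * c k i j); last first.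
  apply/funext => t /=; rewrite tnth_mktuple.
  under [RHS]eq_bigr do rewrite mulr_sumr.
  rewrite [RHS]exchange_big /=; apply: eq_bigr => i _.
  under [RHS]eq_bigr do rewrite mulr_sumr.
  rewrite [RHS]exchange_big /=; apply: eq_bigr => j _.
  rewrite mxE AtE summxE mulr_suml; apply: eq_bigr => l _.
  by rewrite mxE mulrA.
apply: measurable_sum => l.
apply: (@measurable_funM _ (Rn R N) R setT); last exact: measurable_cst.
exact: measurable_tnth.
Qed.

Lemma copK_permT s t : copK (permT s t) <-> copK t.
Proof.
have AtP u r : copK u -> copK (permT r u).
  move=> Ku y y0; rewrite At_permT.
  rewrite (_ : _ + _ = permx r (At u + ones)).
    by rewrite qf_permx; apply: Ku => i.
  by apply/matrixP => i j; rewrite !mxE.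
split=> [/(AtP _ s^-1%g)|]; last exact: AtP.
by have := permTK s^-1 t; rewrite invgK => ->.
Qed.

(** [permT s] maps [copK] to itself, so it preserves volume; it pulls the symmetric part at
    [permT s z] back to the one at [z]. *)
Lemma lebesgue_sym_part_permT s z :
  lebesgueRn N (sym_part copK (permT s z)) = lebesgueRn N (sym_part copK z).
Proof.
have mS := measurable_sym_part (permT s z) measurable_copK.
have preK : permT s @^-1` copK = copK.
  by apply/seteqP; split=> t /= /copK_permT.
rewrite -(lebesgueRn_linear_invariant (measurable_permT s) (permTK s)
  (permT_raff s (- 1)) measurable_copK preK lebesgue_copK mS).
congr (lebesgueRn N _); apply/seteqP; split => w /=; rewrite /sym_part /=;
  by rewrite /radd /rsub -!permT_raff !copK_permT.
Qed.

(** The symmetric group is transitive on indices and on ordered pairs of distinct indices. *)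
Lemma permx_invariant_two_valued (A : 'M[R]_n) : (forall s, permx s A = A) ->
  exists d e, forall i j, A i j = if i == j then d else e.
Proof.
move=> As; have AE (s : {perm 'I_n}) i j : A (s i) (s j) = A i j.
  by rewrite -[in RHS](As s) mxE.
pose o0 : 'I_n := Ordinal (leq_trans (leqnSn 1) n2); pose o1 : 'I_n := Ordinal n2.
exists (A o0 o0), (A o0 o1) => i j; case: eqP => [<-|/eqP ij].
  by rewrite -[RHS](AE (tperm o0 i)) tpermL.
(* [s] moves [o0] to [i] and [o1] to some [k != i]; then [tperm k j] moves [k] to [j] and fixes
   [i]. *)
pose s : {perm 'I_n} := (tperm o0 i)%g; pose k := s o1.
have ki : k != i by rewrite -[i](tpermL o0) (inj_eq perm_inj).
rewrite -[RHS](AE (s * tperm k j)%g) !permM tpermL -/k tpermL.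
by rewrite tpermD// eq_sym.
Qed.

Lemma sym_part_psd z w : copK z ->
  (forall s, permx s (At z) = At z) -> sym_part copK z w ->
  forall t, At t = 9^-1 *: At w + 3^-1 *: ((n%:R + 2)%:M - 3 *: ones) ->
  psd (At t + ones).
Proof.
move=> Kz zs [Kp Km] t tE.
have [d [e de]] := permx_invariant_two_valued zs.
have n0 : 0 <= n%:R + 2 :> R by rewrite addr_ge0.
have zle x : (forall i, 0 <= x i) -> qf (At z + ones) x <= (n%:R + 2) * \sum_i x i ^+ 2.
  move=> x0; apply: (cop_two_valued_le n2 Kz (d := d + 1) (e := e + 1)) => //.
    by move=> i j; rewrite mxE de !mxE; case: eqP.
  exact: lform_K.
(* At nonnegative vectors the form of [At z + ones] dominates both signs of the form of [At w], as
   [z + w] and [z - w] lie in [copK]. *)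
have wle x : (forall i, 0 <= x i) -> `|qf (At w) x| <= (n%:R + 2) * \sum_i x i ^+ 2.
  move=> x0; apply: le_trans (zle x x0).
  have := Kp x x0; have := Km x x0; rewrite !At_raff !qfD !qfZ ler_norml.
  by move=> h1 h2; apply/andP; split; lra.
move=> y; have := psd_of_abs_cop wle y.
(* The [ones] cancel and leave [At w / 9 + (n + 2) / 3 I]. *)
rewrite tE !(qfD, qfN, qfZ) qf_scalar; lra.
Qed.

Theorem volume_psd_ge (S : set (Rn R N)) :
  (forall t, psd (At t + ones) -> S t) ->
  ((27^-1 ^+ N)%:E * lebesgueRn N copK <= lebesgueRn N S)%E.
Proof.
move=> Spsd; have K_fin := lebesgue_copK; have /andP[K0 Koo] := K_fin.
have [r Kr] := copK_bounded.
have Sfin z : lebesgueRn N (sym_part copK z) \is a fin_num.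
  rewrite ge0_fin_numE//; apply: (@lebesgueRn_bounded _ _ _ r) => w.
  exact: sym_part_bounded Kr _ _.
have KfinE : lebesgueRn N copK \is a fin_num by rewrite ge0_fin_numE// ltW.
have [z0 z0P] := large_sym_part N0 measurable_copK K_fin copK_mid.
pose v : R := 3^-1 ^+ N * fine (lebesgueRn N copK).
have v0 : 0 < v by rewrite mulr_gt0 ?exprn_gt0 ?invr_gt0// fine_gt0.
pose z := ravg [seq permT s z0 | s <- enum {perm 'I_n}].
have zv : v <= fine (lebesgueRn N (sym_part copK z)).
  apply: (sym_part_avg measurable_copK Kr copK_mix (ltW v0)).
    rewrite size_map -cardE; apply/card_gt0P; by exists 1%g.
  move=> _ /mapP[s _ ->]; rewrite lebesgue_sym_part_permT.
  by rewrite -lee_fin fineK// EFinM fineK.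
have zperm s : permx s (At z) = At z.
  rewrite At_ravg size_map big_map.
  rewrite (_ : permx s _ = (size (enum {perm 'I_n}))%:R^-1 *:
      permx s (\sum_(j <- enum {perm 'I_n}) At (permT j z0))); last first.
    by apply/matrixP => i j; rewrite !mxE.
  congr (_ *: _); apply/matrixP => i j; rewrite mxE !summxE !big_enum /=.
  (* Applying [s] to the average only translates the summation index within the group. *)
  rewrite (reindex_inj (mulgI (s^-1)%g)); apply: eq_bigr => q _.
  by rewrite !At_permT !mxE !permM !permK.
(* The symmetric part at [z] has positive volume, so it contains some [w], and [z] is the midpoint
   of [z + w] and [z - w]. *)
have Kz : copK z.
  apply: contrapT => nKz; move: zv; rewrite (_ : sym_part _ _ = set0).
    by rewrite measure0 leNgt v0.
  by apply/seteqP; split=> // w [Kp Km]; apply: nKz; exact: copK_mid Kp Km.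
have [t0 t0E] : exists t, At t = 3^-1 *: ((n%:R + 2)%:M - 3 *: ones).
  apply: Asurj.
    by apply/matrixP => i j; rewrite !mxE eq_sym.
  by rewrite lformZ lformD -scaleNr lformZ lform_scalar lform_ones; ring.
(* [S2] is [t0 + K_z / 9], written as the preimage of [K_z] under [u -> 9 (u - t0)]. *)
pose S2 := [set u | sym_part copK z (raff 9 (rscale (- 9) t0) u)].
have mz := measurable_sym_part z measurable_copK.
have S2S : S2 `<=` S.
  move=> u; rewrite /S2 /= => wz; apply: Spsd; apply: (sym_part_psd Kz zperm wz).
  rewrite -t0E -At_raff; congr At; apply: eq_from_tnth => k.
  by rewrite !tnth_raff tnth_mktuple; field.
apply: le_trans (lebesgueRn_monotone S2S).
rewrite [leRHS]lebesgueRn_affine ?pnatr_eq0// ger0_norm//.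
rewrite -(fineK (Sfin z)) -(fineK KfinE) -!EFinM lee_fin.
apply: (@le_trans _ _ (9^-1 ^+ N * v)); last by rewrite ler_wpM2l// exprn_ge0.
by rewrite /v mulrA -exprMn -invfM -natrM.
Qed.

End Core.

(** * Even quartics *)

Section SumOfSquares.
Context {R : realType} {n : nat}.
Implicit Types (A B : 'M[R]_n).

(** Otherwise the form at [s e_i + e_j] is affine in [s] with nonzero slope, and the chosen [s]
    gives it the value -1. *)
Lemma psd_zero_diag A i j : A^T = A -> psd A -> A i i = 0 -> A i j = 0.
Proof.
move=> sA pA Aii; apply: contrapT => /eqP Aij.
have Aji : A j i = A i j by rewrite -[in LHS]sA mxE.
pose s := - (A j j + 1) / (2 * A i j).
have : qf A (fun k => s * delta i k + delta j k) = A j j + 2 * s * A i j.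
  transitivity (\sum_k (s * A k i + A k j) * (s * delta i k + delta j k)).
    apply: eq_bigr => k _.
    rewrite -{1}(sum_delta (A k) i) -(sum_delta (A k) j) mulr_sumr -big_split mulr_suml.
    by apply: eq_bigr => l _ /=; ring.
  under eq_bigr do rewrite mulrDr mulrCA.
  rewrite big_split /= -mulr_sumr (sum_delta (fun k => s * A k i + A k j)).
  by rewrite (sum_delta (fun k => s * A k i + A k j)) Aii Aji; ring.
have := pA (fun k => s * delta i k + delta j k) => /[swap] ->.
have -> : 2 * s * A i j = - (A j j + 1) by rewrite /s; field.
lra.
Qed.

(** The form of the Schur complement at [y] is that of [A] at [y - (v / A i i) e_i], the minimum
    over shifts of [y] along [e_i]. *)
Lemma psd_schur A i : A^T = A -> psd A -> 0 < A i i ->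
  psd (\matrix_(k, l) (A k l - A k i * A l i / A i i)).
Proof.
move=> sA pA Aii y.
have sAE k l : A k l = A l k by rewrite -[in LHS]sA mxE.
set v := \sum_k A k i * y k.
have -> : qf (\matrix_(k, l) (A k l - A k i * A l i / A i i)) y =
    qf A y - v ^+ 2 / A i i.
  rewrite expr2 /v mulrAC mulr_suml mulr_suml /qf -sumrB; apply: eq_bigr => k _.
  rewrite mulr_sumr -sumrB; apply: eq_bigr => l _; rewrite mxE; ring.
have := pA (fun k => y k + - (v / A i i) * delta i k).
suff -> : qf A (fun k => y k + - (v / A i i) * delta i k) = qf A y - v ^+ 2 / A i i by [].
set s := - (v / A i i).
transitivity (\sum_k (\sum_l A k l * y l + s * A k i) * (y k + s * delta i k)).
  apply: eq_bigr => k _.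
  rewrite -{1}(sum_delta (A k) i) mulr_sumr -big_split mulr_suml.
  by apply: eq_bigr => l _ /=; ring.
under eq_bigr do rewrite mulrDr mulrDl mulrCA.
rewrite !big_split /= -mulr_sumr (sum_delta (fun k => \sum_l A k l * y l + s * A k i)).
have -> : \sum_k (\sum_l A k l * y l) * y k = qf A y.
  by apply: eq_bigr => k _; rewrite mulr_suml; apply: eq_bigr => l _; ring.
have -> : \sum_k s * A k i * y k = s * v.
  by rewrite /v mulr_sumr; apply: eq_bigr => k _; ring.
have -> : \sum_l A i l * y l = v by apply: eq_bigr => l _; rewrite sAE.
by rewrite /s; field; rewrite gt_eqF.
Qed.

(** Gaussian elimination, by induction on the number of nonzero diagonal entries: passing to the
    Schur complement [B] clears the [i]-th one, and zero entries stay zero by [psd_zero_diag]. *)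
Lemma psd_sum_squares A : A^T = A -> psd A ->
  exists s : seq ('I_n -> R), forall i j, A i j = \sum_(c <- s) c i * c j.
Proof.
have [k] := ubnP #|[pred i | A i i != 0]|; elim: k A => // k IH A Ak sA pA.
have sAE i j : A i j = A j i by rewrite -[in LHS]sA mxE.
have [/existsP[i Aii]|] := boolP [exists i, A i i != 0]; last first.
  rewrite negb_exists => /forallP A0; exists [::] => i j; rewrite big_nil.
  by apply: psd_zero_diag => //; apply/eqP; have := A0 i; rewrite negbK.
have Aii0 : 0 < A i i by rewrite lt_neqAle eq_sym Aii -qf_delta pA.
pose B := \matrix_(k, l) (A k l - A k i * A l i / A i i).
have [|||s sB] := IH B.
- move: Ak; rewrite ltnS; apply: leq_trans; apply: proper_card.
  apply/fintype.properP; split.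
    apply/fintype.subsetP => l; rewrite !inE mxE; apply: contra => /eqP All.
    by rewrite All (psd_zero_diag i sA pA All) !mul0r subr0.
  exists i; rewrite !inE// mxE negbK mulfK// subrr//.
- by apply/matrixP => l p; rewrite !mxE sAE [A p i * _]mulrC.
- exact: psd_schur.
exists ((fun l => A l i / Num.sqrt (A i i)) :: s) => l p.
rewrite big_cons -sB mxE mulf_div -expr2 sqr_sqrtr ?(ltW Aii0)//.
by rewrite addrC subrK.
Qed.

Definition quartic A : {mpoly R[n]} :=
  \sum_i \sum_j A i j *: ('X_i ^+ 2 * 'X_j ^+ 2).

Lemma meval_quartic A (v : 'I_n -> R) :
  (quartic A).@[v] = qf A (fun i => v i ^+ 2).
Proof.
rewrite raddf_sum; apply: eq_bigr => i _; rewrite raddf_sum.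
by apply: eq_bigr => j _; rewrite /= mevalZ !expr2 !mevalM !mevalXU.
Qed.

Lemma quarticD A B : quartic (A + B) = quartic A + quartic B.
Proof.
rewrite /quartic -big_split; apply: eq_bigr => i _; rewrite -big_split.
by apply: eq_bigr => j _; rewrite mxE scalerDl.
Qed.

Lemma quartic_ones : quartic ones = (\sum_i 'X_i ^+ 2) ^+ 2.
Proof.
rewrite expr2 mulr_suml; apply: eq_bigr => i _; rewrite mulr_sumr.
by apply: eq_bigr => j _; rewrite mxE scale1r.
Qed.

(** Nonnegative vectors are exactly the vectors of squares. *)
Lemma POS_quartic A : A^T = A -> POS_Q (quartic A) <-> cop A.
Proof.
move=> sA; split=> [[_ pos] y y0|cA].
  have := pos [tuple Num.sqrt (y i) | i < n]; rewrite meval_quartic.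
  congr (0 <= _); apply: eq_bigr => i _; apply: eq_bigr => j _.
  by rewrite !tnth_mktuple !sqr_sqrtr.
split; first by exists A.
by move=> x; rewrite meval_quartic; apply: cA => i; exact: sqr_ge0.
Qed.

Lemma SOS_POS (f : {mpoly R[n]}) : SOS_Q f -> POS_Q f.
Proof.
move=> [ef [s _ fE]]; split=> // x; rewrite fE raddf_sum; apply: sumr_ge0 => g _ /=.
by rewrite expr2 mevalM -expr2 sqr_ge0.
Qed.

Lemma psd_SOS A : A^T = A -> psd A -> SOS_Q (quartic A).
Proof.
move=> sA pA; split; first by exists A.
have [s sE] := psd_sum_squares sA pA.
exists [seq \sum_i c i *: 'X_i ^+ 2 | c <- s].
  move=> _ /mapP[c _ ->]; apply: rpred_sum => i _; apply: rpredZ.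
  by have := dhomogMn 2 (_ : 'X_i \is 1.-homog); apply; rewrite dhomogX /= mdeg1.
transitivity (\sum_i \sum_(c <- s) \sum_j
    (c i * c j) *: ('X_i ^+ 2 * 'X_j ^+ 2) : {mpoly R[n]}).
  apply: eq_bigr => i _; rewrite exchange_big; apply: eq_bigr => j _ /=.
  by rewrite sE scaler_suml.
rewrite big_map exchange_big /=; apply: eq_bigr => c _.
rewrite expr2 mulr_suml; apply: eq_bigr => i _; rewrite mulr_sumr.
by apply: eq_bigr => j _; rewrite -scalerAl -scalerAr scalerA.
Qed.

End SumOfSquares.

(** * Integrals over the sphere *)

Section SphereMoments.
Context {R : realType} {n : nat}.
Variable sigma : probability (Rn R n) R.
Hypothesis hsigma : rotation_invariant_on_sphere sigma.
Implicit Types (p q : {mpoly R[n]}) (A : 'M[R]_n) (x : Rn R n).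

Notation S := (@sphere R n).
Notation I := (sphere_int sigma).

Lemma measurable_meval p : measurable_fun setT (fun x : Rn R n => p.@[tnth x]).
Proof.
rewrite (_ : (fun _ => _) =
    fun x => \sum_(m <- msupp p) p@_m * \prod_i tnth x i ^+ m i); last first.
  by apply/funext => x; rewrite mevalE.
apply: measurable_sum => m.
apply: (@measurable_funM _ (Rn R n) R setT); first exact: measurable_cst.
apply: measurable_prod => i _; apply: measurable_funX; exact: measurable_tnth.
Qed.

Lemma measurable_sphere : measurable S.
Proof.
pose q : {mpoly R[n]} := \sum_i 'X_i ^+ 2.
have qE x : q.@[tnth x] = \sum_i tnth x i ^+ 2.
  by rewrite raddf_sum; apply: eq_bigr => i _; rewrite /= !expr2 mevalM mevalXU.
rewrite (_ : S = (fun x : Rn R n => q.@[tnth x]) @^-1` [set 1]); last first.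
  by apply/seteqP; split=> x; rewrite /sphere /= qE.
by rewrite -[X in measurable X]setTI; exact: measurable_meval.
Qed.

Lemma sphere_coord x i : S x -> `|tnth x i| <= 1.
Proof.
move=> Sx; rewrite -(@ler_pXn2r _ 2)// ?nnegrE// expr1n real_normK ?num_real//.
rewrite -[leRHS]Sx (bigD1 i)//= lerDl; apply: sumr_ge0 => j _; exact: sqr_ge0.
Qed.

(** On the sphere a polynomial is bounded by the sum of the absolute values of its coefficients. *)
Lemma integrable_meval p : sigma.-integrable S (EFin \o (fun x => p.@[tnth x])).
Proof.
apply: measurable_bounded_integrable; first exact: measurable_sphere.
- by apply: le_lt_trans (probability_le1 _ measurable_sphere) _; rewrite ltry.
- exact: measurable_funTS (measurable_meval p).
pose B := \sum_(m <- msupp p) `|p@_m|.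
exists B; split; first exact: num_real.
move=> y By x Sx /=; rewrite mevalE; apply: le_trans (ltW By).
apply: le_trans (ler_norm_sum _ _ _) _; apply: ler_sum => m _.
rewrite normrM ler_piMr// normr_prod; apply: prodr_ile1 => i _.
rewrite normr_ge0 normrX exprn_ile1//; exact: sphere_coord.
Qed.

Lemma sphere_intD p q : I (p + q) = I p + I q.
Proof.
rewrite /sphere_int -RintegralD; try exact: integrable_meval.
  by apply: eq_Rintegral => x _; rewrite mevalD.
exact: measurable_sphere.
Qed.

Lemma sphere_intZ (c : R) p : I (c *: p) = c * I p.
Proof.
rewrite /sphere_int -RintegralZl; try exact: integrable_meval.
  by apply: eq_Rintegral => x _; rewrite mevalZ.
exact: measurable_sphere.
Qed.

Lemma sphere_int_sum (J : Type) (s : seq J) (F : J -> {mpoly R[n]}) :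
  I (\sum_(j <- s) F j) = \sum_(j <- s) I (F j).
Proof.
elim/big_rec2: _ => [|j y u _ <-]; last exact: sphere_intD.
by rewrite -[X in I X](scale0r (0 : {mpoly R[n]})) sphere_intZ mul0r.
Qed.

Lemma eq_sphere_int p q : (forall x, p.@[tnth x] = q.@[tnth x]) -> I p = I q.
Proof. by move=> pq; apply: eq_Rintegral => x _; exact: pq. Qed.

Lemma sphere_int1 : I 1 = 1.
Proof.
transitivity (\int[sigma]_(x in S) (1 : R)).
  by apply: eq_Rintegral => x _; rewrite meval1.
rewrite Rintegral_cst; last exact: measurable_sphere.
by rewrite mul1r; exact: (congr1 fine hsigma.1).
Qed.

Lemma tnth_mxact A x i : tnth (mxact A x) i = \sum_j A i j * tnth x j.
Proof. by rewrite tnth_mktuple. Qed.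

Lemma measurable_mxact A : measurable_fun setT (@mxact R n A).
Proof.
apply/measurable_fun_tnthP => i.
rewrite (_ : _ \o _ = fun x => \sum_j A i j * tnth x j); last first.
  by apply/funext => x /=; rewrite tnth_mxact.
apply: measurable_sum => j.
apply: (@measurable_funM _ (Rn R n) R setT); first exact: measurable_cst.
exact: measurable_tnth.
Qed.

Lemma mxact_norm A x : A *m A^T = 1%:M ->
  \sum_i tnth (mxact A x) i ^+ 2 = \sum_i tnth x i ^+ 2.
Proof.
move=> /mulmx1C AA; pose v : 'cV[R]_n := \col_i tnth x i.
have E (u : 'cV[R]_n) : \sum_i u i 0 ^+ 2 = (u^T *m u) 0 0.
  by rewrite mxE; apply: eq_bigr => i _; rewrite mxE expr2.
transitivity (\sum_i (A *m v) i 0 ^+ 2).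
  apply: eq_bigr => i _; rewrite tnth_mxact mxE; congr (_ ^+ 2).
  by apply: eq_bigr => j _; rewrite mxE.
rewrite E trmx_mul mulmxA -(mulmxA v^T) AA mulmx1 -E.
by apply: eq_bigr => i _; rewrite mxE.
Qed.

Lemma sphere_int_rotation A p q : rotation A ->
  (forall x, q.@[tnth x] = p.@[tnth (mxact A x)]) -> I q = I p.
Proof.
move=> rA qp; have [AA _] := rA.
have preS : mxact A @^-1` S = S.
  by apply/seteqP; split=> x; rewrite /sphere /= mxact_norm.
transitivity (\int[sigma]_(x in S) p.@[tnth (mxact A x)]).
  by apply: eq_Rintegral => x _; exact: qp.
rewrite /Rintegral; congr fine.
transitivity (\int[image_measure sigma (measurable_mxact A)]_(y in S)
    (p.@[tnth y])%:E)%E; last first.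
  by apply: eq_measure_integral => X mX _; apply: hsigma.2.
rewrite -{1}preS; apply/esym.
apply: (integral_pushforward (measurable_mxact A) (f := fun y => (p.@[tnth y])%:E)).
- by apply/measurable_EFinP; exact: measurable_meval.
- rewrite preS; apply: eq_integrable (integrable_meval q).
    exact: measurable_sphere.
  by move=> x _ /=; rewrite qp.
- exact: measurable_sphere.
Qed.

Definition even_meval p : Prop := forall x y : Rn R n,
  (forall k, tnth x k ^+ 2 = tnth y k ^+ 2) -> p.@[tnth x] = p.@[tnth y].

(* An orthogonal matrix of determinant -1 becomes a rotation after one sign
   change, which an even polynomial does not see. *)
Lemma sphere_int_orthogonal (i0 : 'I_n) A p q : A *m A^T = 1%:M -> even_meval p ->
  (forall x, q.@[tnth x] = p.@[tnth (mxact A x)]) -> I q = I p.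
Proof.
move=> AA ep qp; have : \det A ^+ 2 == 1 by rewrite expr2 -{2}det_tr -det_mulmx AA det1.
rewrite sqrf_eq1 => /orP[/eqP d1|/eqP dN1]; first exact: sphere_int_rotation qp.
pose d : 'rV[R]_n := \row_i (if i == i0 then - 1 else 1).
have d2 i : d 0 i * d 0 i = 1 by rewrite mxE; case: ifP; rewrite ?mulrNN mulr1.
apply: (sphere_int_rotation (A := diag_mx d *m A)).
  split.
    rewrite trmx_mul tr_diag_mx mulmxA -(mulmxA _ A) AA mulmx1 mulmx_diag.
    rewrite -diag_const_mx; congr diag_mx; apply/rowP => k.
    by rewrite mxE d2 mxE.
  rewrite det_mulmx dN1 det_diag (bigD1 i0)//= big1.
    by rewrite mxE eqxx mulr1 mulrNN mulr1.
  by move=> i ii0; rewrite mxE (negPf ii0).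
move=> x; rewrite qp; apply: ep => k; rewrite !tnth_mxact.
under [in RHS]eq_bigr do rewrite mul_diag_mx mxE -mulrA.
by rewrite -mulr_sumr exprMn [X in X * _]expr2 d2 mul1r.
Qed.

Definition moment i j : R := I ('X_i ^+ 2 * 'X_j ^+ 2).

Lemma meval_moment i j x :
  ('X_i ^+ 2 * 'X_j ^+ 2 : {mpoly R[n]}).@[tnth x] = tnth x i ^+ 2 * tnth x j ^+ 2.
Proof. by rewrite !expr2 !mevalM !mevalXU. Qed.

Lemma even_moment i j : even_meval ('X_i ^+ 2 * 'X_j ^+ 2).
Proof. by move=> x y xy; rewrite !meval_moment !xy. Qed.

Lemma moment_diag i j : moment i i = moment j j.
Proof.
apply: (sphere_int_orthogonal i (A := perm_mx (tperm i j)) _ (@even_moment j j)).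
  by rewrite tr_perm_mx -perm_mxM mulgV perm_mx1.
move=> x; rewrite !meval_moment tnth_mxact.
rewrite (bigD1 i)//= big1 ?addr0.
  by rewrite !mxE tpermR eqxx mul1r.
by move=> k ki; rewrite !mxE tpermR eq_sym (negPf ki) mul0r.
Qed.

Section Givens.
Variables (i j : 'I_n) (c s : R).
Hypotheses (ij : i != j) (cs : c ^+ 2 + s ^+ 2 = 1).

Definition givens : 'M[R]_n := \matrix_(k, l)
  (if k == i then c * delta i l - s * delta j l
   else if k == j then s * delta i l + c * delta j l else delta k l).

Lemma sum_givens (F : 'I_n -> R) k : \sum_l givens k l * F l =
  if k == i then c * F i - s * F j else if k == j then s * F i + c * F j else F k.
Proof.
under eq_bigr do rewrite mxE.
case: ifP => _; last case: ifP => _.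
- rewrite -{1}(sum_delta F i) -(sum_delta F j) !mulr_sumr -sumrB.
  by apply: eq_bigr => l _; ring.
- rewrite -{1}(sum_delta F i) -(sum_delta F j) !mulr_sumr -big_split.
  by apply: eq_bigr => l _ /=; ring.
- by rewrite -[RHS](sum_delta F k); apply: eq_bigr => l _; rewrite mulrC.
Qed.

Lemma givens_orthogonal : givens *m givens^T = 1%:M.
Proof.
apply/matrixP => k l; rewrite !mxE; under eq_bigr do rewrite [givens^T _ _]mxE.
rewrite sum_givens !mxE /delta; have ji : j != i by rewrite eq_sym.
rewrite [i == l]eq_sym [j == l]eq_sym !eqxx (negPf ij) (negPf ji).
have [->|ki] := eqVneq k i; have [li|li] := eqVneq l i; rewrite ?li.
- by rewrite /=; transitivity (c ^+ 2 + s ^+ 2); [ring|rewrite cs].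
- by case: ifP => _ /=; ring.
- by rewrite (negPf ki); case: ifP => [_|->] /=; ring.
have [->|kj] := eqVneq k j; have [lj|lj] := eqVneq l j; rewrite ?lj.
- by rewrite /=; transitivity (c ^+ 2 + s ^+ 2); [ring|rewrite cs].
- by rewrite /=; ring.
- by rewrite ?(negPf kj) /=; ring.
- by [].
Qed.

Lemma sphere_int_givens :
  I ((c *: 'X_i - s *: 'X_j) ^+ 4 + (s *: 'X_i + c *: 'X_j) ^+ 4) =
  moment i i + moment j j.
Proof.
rewrite -sphere_intD; apply: (sphere_int_orthogonal i givens_orthogonal).
  by move=> x y xy; rewrite !mevalD !meval_moment !xy.
move=> x; rewrite !mevalD !meval_moment !tnth_mxact !sum_givens eqxx.
rewrite eq_sym (negPf ij) eqxx.
have e4 (q : {mpoly R[n]}) : (q ^+ 4).@[tnth x] = q.@[tnth x] ^+ 4.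
  by rewrite !exprS expr0 !mevalM meval1.
by rewrite !e4 !(mevalD, mevalN, mevalZ, mevalXU); ring.
Qed.

End Givens.

(* Adding the identities for the two rotations of cosine 3/5 and sine +-4/5
   cancels the odd moments. *)
Lemma moment_offdiag i j : i != j -> moment i i + moment j j = 6 * moment i j.
Proof.
move=> ij.
have cs1 : (3 / 5) ^+ 2 + (4 / 5) ^+ 2 = 1 :> R by field.
have cs2 : (3 / 5) ^+ 2 + (- (4 / 5)) ^+ 2 = 1 :> R by field.
have := congr2 +%R (sphere_int_givens ij cs1) (sphere_int_givens ij cs2).
(* For [c = 3 / 5] and [s = 4 / 5], [674 / 625 = 2 (c^4 + s^4)] and [3456 / 625 = 24 c^2 s^2]. *)
rewrite -sphere_intD (@eq_sphere_int _ ((674 / 625) *: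
   ('X_i ^+ 2 * 'X_i ^+ 2 + 'X_j ^+ 2 * 'X_j ^+ 2) +
   (3456 / 625) *: ('X_i ^+ 2 * 'X_j ^+ 2))).
  rewrite sphere_intD !sphere_intZ sphere_intD.
  rewrite -/(moment i i) -/(moment j j) -/(moment i j).
  by move: (moment i i) (moment j j) (moment i j) => a b d; lra.
move=> x.
have e4 (q : {mpoly R[n]}) : (q ^+ 4).@[tnth x] = q.@[tnth x] ^+ 4.
  by rewrite !exprS expr0 !mevalM meval1.
rewrite !(mevalD, mevalZ, e4, mevalN, mevalXU, meval_moment).
by field.
Qed.

Lemma sphere_int_quartic_moments A :
  I (quartic A) = \sum_i \sum_j A i j * moment i j.
Proof.
rewrite sphere_int_sum; apply: eq_bigr => i _; rewrite sphere_int_sum.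
by apply: eq_bigr => j _; rewrite sphere_intZ.
Qed.

(** The moments are [m] off the diagonal and [3 m] on it, so the integral is [m] times the sum of
    all entries plus twice the trace. *)
Lemma sphere_int_quartic (i0 : 'I_n) A :
  I (quartic A) = moment i0 i0 / 3 * lform A.
Proof.
rewrite sphere_int_quartic_moments.
have mE i j : moment i j = moment i0 i0 / 3 * (1 + 2 * (i == j)%:R).
  have [->|ij] := eqVneq i j; first by rewrite (moment_diag j i0) /=; move: (moment i0 i0) => a; lra.
  have := moment_offdiag ij; rewrite (moment_diag i i0) (moment_diag j i0) /=.
  by move: (moment i j) (moment i0 i0) => a b; lra.
set m := moment i0 i0 / 3 in mE *.
transitivity (\sum_i (m * (2 * A i i) + \sum_j m * A i j)).
  apply: eq_bigr => i _; rewrite (bigD1 i)//= [in RHS](bigD1 i)//= mE eqxx.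
  rewrite (eq_bigr (fun j => m * A i j)); first by rewrite /=; ring.
  by move=> j ji; rewrite mE eq_sym (negPf ji) /=; ring.
rewrite big_split /= -!mulr_sumr /lform mulrDr; congr (_ + _).
rewrite /qf mulr_sumr; apply: eq_bigr => i _; rewrite mulr_sumr.
by apply: eq_bigr => j _; rewrite !mulr1.
Qed.

Lemma sphere_int_quartic_eq0 A : (0 < n)%N -> I (quartic A) = 0 <-> lform A = 0.
Proof.
move=> n0; pose i0 := Ordinal n0; rewrite (sphere_int_quartic i0).
suff m0 : moment i0 i0 / 3 != 0.
  split=> [/eqP|->]; last by rewrite mulr0.
  by rewrite mulf_eq0 (negPf m0) => /eqP.
(* If the factor were 0, so would be the integral of the quartic of [ones], which equals 1 on the
   sphere. *)
apply/eqP => m0.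
have : I (quartic ones) = 1.
  rewrite quartic_ones -sphere_int1; apply: eq_Rintegral => x /set_mem Sx.
  rewrite meval1 expr2 mevalM raddf_sum /=.
  rewrite (eq_bigr (fun i => tnth x i ^+ 2)) ?Sx ?mulr1// => i _.
  by rewrite !expr2 mevalM mevalXU.
by rewrite (sphere_int_quartic i0) m0 mul0r => /eqP; rewrite eq_sym oner_eq0.
Qed.

End SphereMoments.

(** * Comparison of the volumes *)

Section Coordinates.
Context {R : realType} {n : nat}.
Variable sigma : probability (Rn R n) R.
Hypothesis hsigma : rotation_invariant_on_sphere sigma.
Variable phi : {linear 'rV[R]_(dimM n) -> {mpoly R[n]}}.
Hypothesis hphi : linear_isometry sigma phi.
Hypothesis n2 : (2 <= n)%N.

Notation N := (dimM n).
Notation row t := (\row_(i < N) tnth t i).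

(** Polarization: [quartic A] at the square roots of [y] is [qf A y]. Defined by values of [f], it
    is visibly linear in [f]. *)
Definition quartic_mx (f : {mpoly R[n]}) : 'M[R]_n := \matrix_(i, j)
  ((f.@[fun k => Num.sqrt (delta i k + delta j k)]
    - f.@[fun k => Num.sqrt (delta i k)] - f.@[fun k => Num.sqrt (delta j k)]) / 2).

Lemma quarticK (A : 'M[R]_n) : A^T = A -> quartic_mx (quartic A) = A.
Proof.
move=> sA; apply/matrixP => i j; rewrite mxE !meval_quartic.
have sAE : A j i = A i j by rewrite -[in LHS]sA mxE.
have d0 k l : 0 <= delta k l :> R by exact: ler0n.
have E1 k : qf A (fun l => Num.sqrt (delta k l) ^+ 2) = A k k.
  rewrite -[RHS](qf_delta A k); apply: eq_bigr => p _; apply: eq_bigr => q _.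
  by rewrite !sqr_sqrtr.
have -> : qf A (fun l => Num.sqrt (delta i l + delta j l) ^+ 2) =
    A i i + A j j + A i j + A j i.
  rewrite -qf_delta2; apply: eq_bigr => p _; apply: eq_bigr => q _.
  by rewrite !sqr_sqrtr// addr_ge0.
by rewrite !E1 sAE; field.
Qed.

Lemma quartic_mx_sum (I : finType) (a : I -> R) (f : I -> {mpoly R[n]}) :
  quartic_mx (\sum_k a k *: f k) = \sum_k a k *: quartic_mx (f k).
Proof.
have E v : (\sum_k a k *: f k).@[v] = \sum_k a k * (f k).@[v].
  by rewrite raddf_sum; apply: eq_bigr => k _; rewrite /= mevalZ.
apply/matrixP => i j; rewrite mxE summxE !E -!sumrB mulr_suml.
by apply: eq_bigr => k _ /=; rewrite !mxE; ring.
Qed.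

Lemma row_sum (t : Rn R N) : row t = \sum_k tnth t k *: delta_mx 0 k.
Proof. by rewrite [LHS]row_sum_delta; apply: eq_bigr => k _; rewrite mxE. Qed.

Definition coord_mx (t : Rn R N) : 'M[R]_n := quartic_mx (phi (row t)).

Lemma coord_mxE t :
  coord_mx t = \sum_k tnth t k *: quartic_mx (phi (delta_mx 0 k)).
Proof.
rewrite /coord_mx row_sum linear_sum -quartic_mx_sum.
by congr quartic_mx; apply: eq_bigr => k _; rewrite linearZ.
Qed.

Let n0 : (0 < n)%N. Proof. exact: ltn_trans n2. Qed.

Lemma phi_mean_zero u : mean_zero sigma (phi u).
Proof. by rewrite -hphi.1; exists u. Qed.

Lemma coord_mxP t :
  [/\ (coord_mx t)^T = coord_mx t, lform (coord_mx t) = 0 &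
      phi (row t) = quartic (coord_mx t)].
Proof.
have [[A sA phiA] mz] := phi_mean_zero (row t).
have E : coord_mx t = A by rewrite /coord_mx phiA quarticK.
rewrite E; split=> //; apply/(sphere_int_quartic_eq0 hsigma) => //.
by rewrite -mz phiA.
Qed.

Lemma coord_mx_surj A : A^T = A -> lform A = 0 -> exists t, coord_mx t = A.
Proof.
move=> sA lA; have : mean_zero sigma (quartic A).
  by split; [exists A|apply/(sphere_int_quartic_eq0 hsigma)].
rewrite -hphi.1 => -[u _ phiu]; exists [tuple u 0 i | i < N].
rewrite /coord_mx (_ : row _ = u) ?phiu ?quarticK//.
by apply/rowP => i; rewrite mxE tnth_mktuple.
Qed.

(** As [phi] is an isometry, the coordinate is the inner product with the image of a basis vector,
    which is linear in the matrix. *)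
Lemma coord_mx_coord t k : tnth t k = \sum_i \sum_j coord_mx t i j *
  (\matrix_(i, j) sphere_int sigma ('X_i ^+ 2 * 'X_j ^+ 2 * phi (delta_mx 0 k))) i j.
Proof.
transitivity (sphere_int sigma (phi (row t) * phi (delta_mx 0 k))).
  rewrite hphi.2 (bigD1 k)//= big1 ?addr0; first by rewrite !mxE !eqxx mulr1.
  by move=> i ik; rewrite !mxE (negPf ik) mulr0.
have [_ _ ->] := coord_mxP t.
rewrite /quartic mulr_suml sphere_int_sum; apply: eq_bigr => i _.
rewrite mulr_suml sphere_int_sum; apply: eq_bigr => j _.
by rewrite -scalerAl sphere_intZ mxE.
Qed.

Lemma dimM_gt0 : (0 < N)%N.
Proof.
rewrite /dimM subn_gt0; apply: (@leq_trans (2 * 3)./2) => //.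
by apply: half_leq; apply: leq_mul.
Qed.

Definition pos_set : set (Rn R N) := [set t | POS_tilde sigma (phi (row t))].
Definition sos_set : set (Rn R N) := [set t | SOS_tilde sigma (phi (row t))].
Definition ball_set : set (Rn R N) := [set t | unit_ball sigma (phi (row t))].

Lemma phi_add_ones t :
  phi (row t) + (\sum_i 'X_i ^+ 2) ^+ 2 = quartic (coord_mx t + ones).
Proof. by have [_ _ ->] := coord_mxP t; rewrite quarticD quartic_ones. Qed.

Lemma sym_coord_ones t : (coord_mx t + ones)^T = coord_mx t + ones.
Proof. by have [sA _ _] := coord_mxP t; rewrite linearD /= sA trmx_const. Qed.

Lemma pos_setE : pos_set = copK coord_mx.
Proof.
apply/seteqP; split=> t.
  by move=> [_]; rewrite phi_add_ones => /(POS_quartic (sym_coord_ones t)).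
move=> /(POS_quartic (sym_coord_ones t)); rewrite -phi_add_ones => pos.
by split=> //; exact: phi_mean_zero.
Qed.

Lemma sos_pos : sos_set `<=` pos_set.
Proof. by move=> t [mz /SOS_POS]. Qed.

Lemma psd_sos_set t : psd (coord_mx t + ones) -> sos_set t.
Proof.
move=> /(psd_SOS (sym_coord_ones t)); rewrite -phi_add_ones => sos.
by split=> //; exact: phi_mean_zero.
Qed.

Lemma lebesgue_pos_set : (0 < lebesgueRn N pos_set < +oo)%E.
Proof.
rewrite pos_setE; apply: (lebesgue_copK coord_mxE _ _ coord_mx_coord).
- by move=> t; case: (coord_mxP t).
- by move=> t; case: (coord_mxP t).
Qed.

Lemma lebesgue_sos_set :
  ((27^-1 ^+ N)%:E * lebesgueRn N pos_set <= lebesgueRn N sos_set)%E.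
Proof.
rewrite pos_setE.
apply: (volume_psd_ge coord_mxE _ _ coord_mx_surj coord_mx_coord n2 dimM_gt0 psd_sos_set).
- by move=> t; case: (coord_mxP t).
- by move=> t; case: (coord_mxP t).
Qed.

Lemma ball_setE : ball_set = [set t | \sum_(i < N) tnth t i ^+ 2 <= 1].
Proof.
have E t : sphere_int sigma (phi (row t) * phi (row t)) = \sum_(i < N) tnth t i ^+ 2.
  by rewrite hphi.2; apply: eq_bigr => i _; rewrite mxE expr2.
apply/seteqP; split=> t; first by move=> [_]; rewrite E.
by move=> t1; split; [exact: phi_mean_zero|rewrite E].
Qed.

(** The ball lies between two cubes. Its exact volume cancels in the ratio of the volume radii. *)
Lemma lebesgue_ball_set : (0 < lebesgueRn N ball_set < +oo)%E.
Proof.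
rewrite ball_setE; have N1 : 0 < N%:R :> R by rewrite ltr0n dimM_gt0.
have N1' : 1 <= N%:R :> R by rewrite ler1n dimM_gt0.
apply/andP; split.
  apply: (@lebesgueRn_gt0 _ _ _ N%:R^-1); first by rewrite invr_gt0.
  move=> t td /=; apply: (@le_trans _ _ (\sum_(i < N) N%:R^-1)).
    apply: ler_sum => i _; rewrite -real_normK ?num_real// expr2.
    rewrite -[leRHS]mulr1; apply: ler_pM => //.
    by apply: le_trans (td i) _; rewrite invf_le1.
  by rewrite sumr_const card_ord -[_ *+ _]mulr_natl mulfV// gt_eqF.
apply: (@lebesgueRn_bounded _ _ _ 1) => t /= t1 i.
rewrite -(@ler_pXn2r _ 2)// ?nnegrE// expr1n real_normK ?num_real//.
apply: le_trans t1; rewrite (bigD1 i)//= lerDl; apply: sumr_ge0 => j _; exact: sqr_ge0.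
Qed.

End Coordinates.

Unset Implicit Arguments.
Set Strict Implicit.
Set Printing Implicit Defensive.
Local Close Scope classical_set_scope.

Theorem theorem1p7 (R : realType) (n : nat) (hn : (2 <= n)%N)
    (sigma : probability (Rn R n) R)
    (hsigma : rotation_invariant_on_sphere sigma)
    (phi : {linear 'rV[R]_(dimM n) -> {mpoly R[n]}})
    (hphi : linear_isometry sigma phi) :
  (2 ^+ 8 * 3 ^+ 2)^-1
    <= vrad sigma phi (SOS_tilde sigma) / vrad sigma phi (POS_tilde sigma) <= 1.
Proof.
rewrite /vrad.
have /andP[K0 Koo] := lebesgue_pos_set hsigma hphi hn.
have /andP[B0 Boo] := lebesgue_ball_set hphi hn.
have leSK := lebesgueRn_monotone (@sos_pos R n sigma phi).
have geSK := lebesgue_sos_set hsigma hphi hn.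
have N0 := dimM_gt0 hn.
rewrite -[Vol phi (SOS_tilde sigma)]/(lebesgueRn _ (sos_set sigma phi)).
rewrite -[Vol phi (POS_tilde sigma)]/(lebesgueRn _ (pos_set sigma phi)).
rewrite -[Vol phi (unit_ball sigma)]/(lebesgueRn _ (ball_set sigma phi)).
have Kfin : lebesgueRn (dimM n) (pos_set sigma phi) \is a fin_num.
  by rewrite ge0_fin_numE// ltW.
have Sfin : lebesgueRn (dimM n) (sos_set sigma phi) \is a fin_num.
  rewrite ge0_fin_numE; last exact: measure_ge0.
  exact: le_lt_trans leSK Koo.
set k := fine (lebesgueRn _ (pos_set _ _)).
set s := fine (lebesgueRn _ (sos_set _ _)).
set b := fine (lebesgueRn _ (ball_set _ _)).
have k0 : 0 < k by apply: fine_gt0; rewrite K0.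
have b0 : 0 < b by apply: fine_gt0; rewrite B0.
have sk : s <= k by apply: fine_le.
have ks : 27^-1 ^+ dimM n * k <= s.
  by rewrite -lee_fin EFinM !fineK.
have c0 : 0 <= 27^-1 ^+ dimM n :> R by rewrite exprn_ge0.
have s0 : 0 <= s by apply: le_trans ks; rewrite mulr_ge0// ltW.
have p0 : 0 <= (dimM n)%:R^-1 :> R by rewrite invr_ge0.
have kb0 : 0 < k / b by rewrite divr_gt0.
rewrite ler_pdivlMr ?powR_gt0// ler_pdivrMr ?powR_gt0// mul1r; apply/andP; split; last first.
  by apply: ge0_ler_powR; rewrite ?nnegrE ?divr_ge0 ?(ltW k0) ?(ltW b0)// ler_pM2r ?invr_gt0.
(* The root of order [dimM n] turns the volume factor into [27^-1]. *)
apply: (@le_trans _ _ ((27^-1 ^+ dimM n * (k / b)) `^ (dimM n)%:R^-1)); last first.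
  apply: ge0_ler_powR => //; rewrite ?nnegrE.
  - by rewrite mulr_ge0// ltW.
  - by rewrite divr_ge0// ltW.
  - by rewrite mulrA ler_pM2r ?invr_gt0.
rewrite [leRHS]powRM ?(ltW kb0)//.
have -> : (27^-1 ^+ dimM n) `^ (dimM n)%:R^-1 = 27^-1 :> R.
  by rewrite -powR_mulrn// -powRrM mulfV ?pnatr_eq0 -?lt0n// powRr1.
by rewrite ler_wpM2r ?powR_ge0// lef_pV2 ?posrE; lra.
Qed.
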